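(* Let $n,m,\hbar\in\mathbb{N}^+$, $A\in\mathbb{R}^{n\times n}$, $\{B_k\}_{k=1}^{\hbar}\subset\mathbb{R}^{n\times m}$, and let $\mathcal{B}:=(B_1\ B_2\ \cdots\ B_\hbar)\in\mathbb{R}^{n\times m\hbar}$. If the pair $(A,\{B_k\}_{k=1}^{\hbar})$ is $\hbar$-stabilizable, then for any $\Lambda_\hbar\in\mathfrak{I}_\hbar\cap\mathfrak{L}_{A,\mathcal{B},\hbar}$, the system $(A,\{B_k\}_{k=1}^{\hbar},\Lambda_\hbar)$ is $\hbar$-stabilizable.
   Context: $\mathbb{N}=\{0,1,2,\dots\}$, $\mathbb{N}^+=\{1,2,\dots\}$, $\mathbb{R}^+=[0,\infty)$. $\mathfrak{I}_\hbar$ is the set of all sequences $\Lambda_\hbar=\{t_j\}_{j\in\mathbb{N}}$ with $t_0=0<t_1<t_2<\cdots$ and $t_{j+\hbar}-t_j=t_\hbar$ for all $j\in\mathbb{N}^+$. For $s>0$ let $[s]:=\max\{k\in\mathbb{N}:k<s\}$, and for $j\in\mathbb{N}^+$ let $\vartheta(j):=j-[j/\hbar]\hbar\in\{1,\dots,\hbar\}$. For $\Lambda_\hbar\in\mathfrak{I}_\hbar$, the system $(A,\{B_k\}_{k=1}^{\hbar},\Lambda_\hbar)$ is $$x'(t)=Ax(t),\ t\in\mathbb{R}^+\setminus\Lambda_\hbar;\qquad \triangle x(t_j)=B_{\vartheta(j)}u_j,\ j\in\mathbb{N}^+,$$ where $\triangle x(t_j):=x(t_j^+)-x(t_j)$,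 $u_j\in\mathbb{R}^m$, and solutions are left continuous on $\mathbb{R}^+$ and continuous off $\{t_j\}_{j\in\mathbb{N}^+}$. It is $\hbar$-stabilizable if there is $\{F_k\}_{k=1}^{\hbar}\subset\mathbb{R}^{m\times n}$ such that the closed-loop system $$x'(t)=Ax(t),\ t\in\mathbb{R}^+\setminus\Lambda_\hbar;\qquad \triangle x(t_j)=B_{\vartheta(j)}F_{\vartheta(j)}x(t_j),\ j\in\mathbb{N}^+,$$ is stable, i.e. there are $M>0$, $\mu>0$ such that every solution satisfies $\|x(t)\|\le Me^{-\mu t}\|x(0)\|$ for all $t\in\mathbb{R}^+$. The pair $(A,\{B_k\}_{k=1}^{\hbar})$ is $\hbar$-stabilizable if there is some $\Lambda_\hbar\in\mathfrak{I}_\hbar$ such that the system $(A,\{B_k\}_{k=1}^{\hbar},\Lambda_\hbar)$ is $\hbar$-stabilizable. Let $d_A:=\min\{\pi/|\mathrm{Im}\,\lambda|:\lambda\in\sigma(A)\}$, with the convention $\frac10=+\infty$. For $C\in\mathbb{R}^{i\times i}$, $D\in\mathbb{R}^{i\times k}$ let $q^{i,k}(C,D):=\max\{\dim\mathcal{V}^i_C(d):d\text{ is a column of }D\}$, where $\mathcal{V}^i_C(d):=\mathrm{span}\{d,Cd,\dots,C^{i-1}d\}$. Let $$\mathfrak{L}_{A,\mathcal{B},\hbar}:=\{\{t_j\}_{j\in\mathbb{N}}\subset\mathbb{R}^+:\mathrm{Card}((s,s+d_A)\cap\{t_j\}_{j\in\mathbb{N}})\ge\hbar(q^{n,m\hbar}(A,\mathcal{B})+2)\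 \ \forall s\in\mathbb{R}^+\},$$ where $\mathrm{Card}$ denotes the number of elements. *)

(* Defs.v *)
From HB Require Import structures.
From mathcomp Require Import all_boot all_order all_algebra.
From mathcomp Require Import complex.
From mathcomp Require Import all_classical all_reals all_analysis.
Import Order.TTheory GRing.Theory Num.Theory numFieldNormedType.Exports.

Set Implicit Arguments.
Unset Strict Implicit.
Unset Printing Implicit Defensive.

Local Open Scope classical_set_scope.
Local Open Scope card_scope.
Local Open Scope ring_scope.

(* [p/q] = max {k : nat | k < p/q} for positive integers p, q, where
   k < p/q means k * q < p; every such k is smaller than p, so bounding the
   range of the maximum by p loses nothing. *)
Definition strict_floor (p q : nat) : nat :=
  (\max_(k < p | (k * q < p)%N) k)%N.

(* The index of the control matrix acting at time t_j (j >= 1), which lies in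
   {1, ..., hbar}. *)
Definition vartheta (hbar j : nat) : nat := (j - strict_floor j hbar * hbar)%N.

Lemma strict_floorE (p q : nat) : (0 < p)%N -> (0 < q)%N ->
  strict_floor p q = (p.-1 %/ q)%N.
Proof.
case: p => // p _ q_gt0; apply/eqP; rewrite eqn_leq; apply/andP; split.
  by apply/bigmax_leqP => k kq; rewrite leq_divRL.
have lt_k : (p %/ q < p.+1)%N by rewrite ltnS leq_div.
apply: (@leq_bigmax_cond _ _ (fun k : 'I_p.+1 => k : nat) (Ordinal lt_k)).
by rewrite /= ltnS leq_divM.
Qed.

Lemma varthetaE (hbar j : nat) : (0 < hbar)%N -> (0 < j)%N ->
  vartheta hbar j = (j.-1 %% hbar).+1.
Proof.
move=> h_gt0 j_gt0; rewrite /vartheta strict_floorE//.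
case: j j_gt0 => // j _ /=.
by rewrite {1}(divn_eq j hbar) -addnS addKn.
Qed.

Lemma vartheta_bounds (hbar j : nat) : (0 < hbar)%N -> (0 < j)%N ->
  (0 < vartheta hbar j <= hbar)%N.
Proof. by move=> h_gt0 j_gt0; rewrite varthetaE//= ltn_pmod. Qed.

Section Defs.
Variable R : realType.

Definition enorm (n : nat) (v : 'cV[R]_n) : R :=
  Num.sqrt (\sum_(i < n) v i ord0 ^+ 2).

Definition impulse_times (hbar : nat) (t : nat -> R) : Prop :=
  [/\ t 0%N = 0,
      (forall j, t j < t j.+1) &
      (forall j, (0 < j)%N -> t (j + hbar)%N - t j = t hbar)].

(* Only the values of x on [0, +oo[ matter. Families indexed by {1, ..., hbar}
   are functions on 'I_hbar, so that B_{k+1} is B k; hence the condition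
   k.+1 = vartheta hbar j, which determines k. *)
Definition closed_loop_solution (n m hbar : nat) (A : 'M[R]_n)
    (B : 'I_hbar -> 'M[R]_(n, m)) (F : 'I_hbar -> 'M[R]_(m, n))
    (t : nat -> R) (x : R -> 'cV[R]_n) : Prop :=
  [/\ (forall s : R, 0 < s -> x @ s^'- --> x s),
      (forall s : R, 0 <= s -> (forall j, (0 < j)%N -> s != t j) ->
         x @ within [set r | 0 <= r] (nbhs s) --> x s),
      (forall s : R, 0 <= s -> ~ range t s ->
         is_derive s (1 : R) x (A *m x s)) &
      (forall (j : nat) (k : 'I_hbar), (0 < j)%N -> k.+1 = vartheta hbar j ->
         exists2 xp : 'cV[R]_n, x @ (t j)^'+ --> xp &
           xp - x (t j) = B k *m F k *m x (t j))].

Definition closed_loop_stable (n m hbar : nat) (A : 'M[R]_n)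
    (B : 'I_hbar -> 'M[R]_(n, m)) (F : 'I_hbar -> 'M[R]_(m, n))
    (t : nat -> R) : Prop :=
  exists M mu : R, [/\ 0 < M, 0 < mu &
    forall x : R -> 'cV[R]_n, closed_loop_solution A B F t x ->
      forall s : R, 0 <= s -> enorm (x s) <= M * expR (- mu * s) * enorm (x 0)].

Definition system_stabilizable (n m hbar : nat) (A : 'M[R]_n)
    (B : 'I_hbar -> 'M[R]_(n, m)) (t : nat -> R) : Prop :=
  exists F : 'I_hbar -> 'M[R]_(m, n), closed_loop_stable A B F t.

Definition pair_stabilizable (n m hbar : nat) (A : 'M[R]_n)
    (B : 'I_hbar -> 'M[R]_(n, m)) : Prop :=
  exists2 t : nat -> R, impulse_times hbar t & system_stabilizable A B t.

Definition spectrum (n : nat) (A : 'M[R]_n) : set R[i] :=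
  [set z | eigenvalue (map_mx (real_complex R) A) z].

(* The spectrum is finite, and nonempty when n > 0, so this infimum in the
   extended reals is a minimum. *)
Definition dA (n : nat) (A : 'M[R]_n) : \bar R :=
  ereal_inf [set (if complex.Im z == 0 then +oo%E
                  else (pi / `|complex.Im z|)%:E) | z in spectrum A].

Definition krylov (i : nat) (C : 'M[R]_i) (d : 'cV[R]_i) : {vspace 'cV[R]_i} :=
  <<[seq C ^+ l *m d | l <- iota 0 i]>>%VS.

Definition qmax (i k : nat) (C : 'M[R]_i) (D : 'M[R]_(i, k)) : nat :=
  (\max_(c < k) \dim (krylov C (col c D)))%N.

Definition dense_times (n k hbar : nat) (A : 'M[R]_n) (D : 'M[R]_(n, k))
    (t : nat -> R) : Prop :=
  (forall j, 0 <= t j) /\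
  forall s : R, 0 <= s ->
    `I_(hbar * (qmax A D + 2))%N #<=
      ([set r : R | s < r /\ (r%:E < s%:E + dA A)%E] `&` range t).

End Defs.

(* Main.v *)
Require Import Defs.
From mathcomp Require Import all_boot all_order all_algebra.
From mathcomp Require Import complex.
From mathcomp Require Import all_classical all_reals all_analysis.
From mathcomp Require Import ring lra.
Import Order.TTheory GRing.Theory Num.Theory numFieldNormedType.Exports.

(** Write [T = t hbar] for the period of the impulse instants and [q] for the
    largest dimension of the Krylov space of a column of the [B_k].  Let the
    controllable subspace be the span of the columns of all [exp(s A) B_k].

    Stabilizability for some sequence of instants forces [exp(s A)] to tend to
    zero modulo the controllable subspace: impulses only move the state inside
    that subspace, so a decaying closed-loop trajectory started at [y] differs
    from [exp(s A) y] by one of its elements ([pair_stabilizable_decay]).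

    Conversely, the density condition gives [q T < dA A]
    ([dense_times_period]).  An output [phi exp(s A) d] solves a scalar linear
    equation of order at most [q] whose characteristic roots are eigenvalues of
    [A].  On an interval of length less than [dA A] such an equation is
    disconjugate: by repeated use of Rolle's theorem, a nonzero solution has
    fewer zeros than the order ([observed_eq0]).  Hence the impulses of phase
    [k] over [q] periods already reach everything that the [exp(s A) B_k] span
    ([observed_eq0_sampled]), and over enough periods there are controls, linear
    in the initial state, that halve its squared norm
    ([steering_contraction]).

    These open-loop controls are turned into a memoryless feedback of period
    [hbar] by finite-horizon linear-quadratic regulation.  The contraction
    bounds the value functions uniformly in the horizon.  As they increase with
    the horizon, two consecutive ones are close for some horizon, and the
    corresponding receding-horizon gains, which inherit the period [hbar] of the
    data, make the value function decrease along the closed loop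
    ([periodic_lyapunov_feedback]).  Exponential decay at the impulse instants
    extends to all times because [exp(s A)] is bounded for [s] in [[0, T]]
    ([feedback_stable]). *)

Set Implicit Arguments.
Unset Strict Implicit.
Unset Printing Implicit Defensive.

Local Open Scope classical_set_scope.
Local Open Scope ring_scope.

(** * The matrix exponential *)

Section MatrixCalculus.
Variable R : realType.

(** Entrywise derivative of a matrix-valued function of a real variable.  It
    agrees with [is_derive] for the norm topology (lemma [is_derive_mderiv])
    and behaves well with products of matrices of different shapes. *)
Definition mderiv (p q : nat) (M : R -> 'M[R]_(p, q)) (x : R)
    (M' : 'M[R]_(p, q)) : Prop :=
  forall i j, is_derive x 1 (fun t => M t i j) (M' i j).

Lemma mderiv_cst p q (C : 'M[R]_(p, q)) x : mderiv (fun=> C) x 0.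
Proof. by move=> i j; rewrite mxE; exact: is_derive_cst. Qed.

Lemma mderivM p q r (M : R -> 'M[R]_(p, q)) (N : R -> 'M[R]_(q, r)) x M' N' :
  mderiv M x M' -> mderiv N x N' ->
  mderiv (fun t => M t *m N t) x (M' *m N x + M x *m N').
Proof.
move=> dM dN i j.
have -> : (fun t => (M t *m N t) i j) =
    \sum_(l < q) (fun t => M t i l * N t l j).
  by apply/funext => t; rewrite mxE fct_sumE.
apply: is_derive_eq.
  by apply: is_derive_sum => l; apply: (is_deriveM (dM i l) (dN l j)).
rewrite !mxE -big_split /=; apply: eq_bigr => l _.
by rewrite /GRing.scale /= addrC [N x l j * _]mulrC.
Qed.

Lemma is_derive_mderiv p q (M : R -> 'M[R]_(p, q)) x M' :
  is_derive x (1 : R) M M' <-> mderiv M x M'.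
Proof.
split=> [dM i j|dM].
  have dx : derivable M x 1 by apply: ex_derive.
  apply: DeriveDef; first exact/(derivable_mxP M x 1).1.
  by have := derive_mx dx; rewrite derive_val => /matrixP/(_ i j); rewrite mxE.
have dx : derivable M x 1.
  by apply/derivable_mxP => i j; apply: ex_derive.
apply: DeriveDef => //; rewrite derive_mx//; apply/matrixP => i j; rewrite mxE.
by have := dM i j; move=> ?; rewrite derive_val.
Qed.

Lemma cvg_mxP p q (F : set_system R) (FF : Filter F) (M : R -> 'M[R]_(p, q))
    (L : 'M[R]_(p, q)) :
  M x @[x --> F] --> L <-> forall i j, M x i j @[x --> F] --> L i j.
Proof.
split=> [ML i j|ML].
  by apply: cvg_trans (cvg_comp _ _ ML (@coord_continuous _ _ _ i j L)).
move=> P /= [Q Qn QP].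
have : \forall x \near F, forall ij : 'I_p * 'I_q, Q ij.1 ij.2 (M x ij.1 ij.2).
  by apply: filter_forall => -[i j]; exact: (ML i j _ (Qn i j)).
by apply: filterS => x Qx; apply: QP => i j; exact: (Qx (i, j)).
Qed.

Lemma mderiv_cvg p q (M : R -> 'M[R]_(p, q)) x M' :
  mderiv M x M' -> M @ x --> M x.
Proof.
move=> dM; apply/cvg_mxP => i j.
apply/differentiable_continuous/derivable1_diffP.
by have := dM i j => ?; apply: ex_derive.
Qed.

Lemma derive0_itv_cst (f : R -> R) (a b : R) :
  (forall x, a < x < b -> is_derive x 1 f 0) ->
  forall x y, a < x < b -> a < y < b -> f x = f y.
Proof.
move=> df.
suff lt_eq x y : a < x -> x < y -> y < b -> f x = f y.
  move=> x y /andP[ax xb] /andP[ay yb].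
  have [xy|yx|->//] := ltgtP x y; first exact: lt_eq.
  by apply/esym/lt_eq.
move=> ax xy yb.
have itvP z : z \in `[x, y] -> a < z < b.
  rewrite in_itv /= => /andP[xz zy].
  by rewrite (lt_le_trans ax) //= (le_lt_trans zy).
have [||c _] := @MVT R f (fun=> 0) x y xy.
- by move=> z zxy; apply: df; apply: itvP; exact: subset_itv_oo_cc.
- apply: derivable_within_continuous => z /itvP zab.
  by have := df z zab => ?; apply: ex_derive.
by rewrite mul0r => /subr0_eq ->.
Qed.

Section MatrixExponential.
Variables (n : nat) (A : 'M[R]_n).

(** The coefficients of the power series, in the variable [t], of the entries of
    [M exp(t A)].
    Multiplying by [M] on the left makes the family stable under
    differentiation: the derivative of the series of [M] is that of [M A]. *)
Definition mexp_coef p (M : 'M[R]_(p, n)) i j (k : nat) : R :=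
  (M *m A ^+ k) i j / k`!%:R.

(** The matrix exponential [exp(t A)], defined entry by entry as the sum of its
    power series in [t]. *)
Definition mexp (t : R) : 'M[R]_n :=
  \matrix_(i, j) limn (pseries (mexp_coef 1%:M i j) t).

Let alpha : R := \sum_i \sum_j `|A i j|.

(** With [alpha] the sum of the absolute values of the entries of [A], the
    entries of [A ^+ k] are at most [alpha ^+ k], so that the series of
    [exp(t A)] is dominated by a scalar exponential series. *)
Lemma expr_mx_bound k i j : `|(A ^+ k) i j| <= alpha ^+ k.
Proof.
have alpha_ge0 : 0 <= alpha by do 2! apply: sumr_ge0 => ? _.
elim: k i j => [|k IH] i j.
  by rewrite !expr0 mxE; case: (_ == _); rewrite ?normr1// normr0.
rewrite !exprS mxE; apply: le_trans (ler_norm_sum _ _ _) _.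
apply: (@le_trans _ _ (\sum_l `|A i l| * alpha ^+ k)).
  by apply: ler_sum => l _; rewrite normrM ler_wpM2l.
rewrite -mulr_suml ler_wpM2r ?exprn_ge0// /alpha.
rewrite [leRHS](bigD1 i)//= lerDl; apply: sumr_ge0 => ? _.
by apply: sumr_ge0.
Qed.

Lemma cvg_mexp_coef p (M : 'M[R]_(p, n)) i j t :
  cvgn (pseries (mexp_coef M i j) t).
Proof.
have alpha_ge0 : 0 <= alpha by do 2! apply: sumr_ge0 => ? _.
pose beta : R := \sum_l `|M i l|.
apply: normed_cvg.
have cvgb : cvgn (series (fun k => beta * exp_coeff (alpha * `|t|) k)).
  rewrite -[fun k => _]/(beta *: exp_coeff (alpha * `|t|)).
  exact/is_cvg_seriesZ/is_cvg_series_exp_coeff.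
apply: series_le_cvg cvgb => [k|k|k] /=; rewrite ?normr_ge0//.
  rewrite mulr_ge0 ?sumr_ge0// /exp_coeff /= divr_ge0//.
  by rewrite exprn_ge0 ?mulr_ge0.
rewrite /mexp_coef /exp_coeff /= !normrM normfV normr_nat normrX exprMn.
rewrite !mulrA [leLHS]mulrAC !ler_wpM2r ?exprn_ge0//.
rewrite mxE; apply: le_trans (ler_norm_sum _ _ _) _.
rewrite mulr_suml; apply: ler_sum => l _; rewrite normrM ler_wpM2l//.
exact: expr_mx_bound.
Qed.

(** Sums of power series commute with finite linear combinations. *)
Lemma lim_pseries_sum q (c : 'I_q -> R) (u : 'I_q -> nat -> R) v t :
  (forall l, cvgn (pseries (u l) t)) ->
  (forall k, v k = \sum_l c l * u l k) ->
  limn (pseries v t) = \sum_l c l * limn (pseries (u l) t).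
Proof.
move=> cu vE; apply/cvg_lim => //.
have -> : pseries v t = fun N => \sum_l c l * pseries (u l) t N.
  apply/funext => N; rewrite /pseries /series /=.
  under [RHS]eq_bigr do rewrite mulr_sumr.
  rewrite exchange_big /=; apply: eq_bigr => k _.
  by rewrite vE mulr_suml; apply: eq_bigr => l _; rewrite mulrA.
by apply: cvg_big => // [|l _]; [exact: add_continuous|apply: cvgMl_tmp; exact: cu].
Qed.

(** The sum of the series [mexp_coef M], which turns out to be [M exp(t A)]. *)
Definition mexp_mul p (M : 'M[R]_(p, n)) (t : R) : 'M[R]_(p, n) :=
  \matrix_(i, j) limn (pseries (mexp_coef M i j) t).

Lemma mexp_mulE p (M : 'M[R]_(p, n)) t : mexp_mul M t = M *m mexp t.
Proof.
apply/matrixP => i j; rewrite !mxE.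
under eq_bigr do rewrite mxE.
apply: lim_pseries_sum => [l|k]; first exact: cvg_mexp_coef.
rewrite /mexp_coef mxE mulr_suml; apply: eq_bigr => l _.
by rewrite mul1mx mulrA.
Qed.

Lemma mexp_mulC t : mexp_mul A t = mexp t *m A.
Proof.
apply/matrixP => i j; rewrite !mxE.
under eq_bigr do rewrite mxE mulrC.
apply: lim_pseries_sum => [l|k]; first exact: cvg_mexp_coef.
rewrite /mexp_coef -[A *m _]/(A * A ^+ k) -exprS exprSr mxE mulr_suml.
by apply: eq_bigr => l _; rewrite mul1mx mulrA [A l j * _]mulrC.
Qed.

Lemma pseries_diffs_mexp_coef p (M : 'M[R]_(p, n)) i j :
  pseries_diffs (mexp_coef M i j) = mexp_coef (M *m A) i j.
Proof.
apply/funext => k; rewrite /pseries_diffs /mexp_coef exprS.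
rewrite -[A * _]/(A *m A ^+ k) mulmxA factS natrM invfM mulrCA mulrA.
by rewrite mulrA mulfK ?pnatr_eq0.
Qed.

Lemma mderiv_mexp_mul p (M : 'M[R]_(p, n)) t :
  mderiv (mexp_mul M) t (mexp_mul (M *m A) t).
Proof.
move=> i j; rewrite mxE.
have -> : (fun t => mexp_mul M t i j) =
    (fun t => limn (pseries (mexp_coef M i j) t)).
  by apply/funext => s; rewrite mxE.
rewrite -pseries_diffs_mexp_coef.
apply: (@pseries_snd_diffs _ _ (`|t| + 1)).
- exact: cvg_mexp_coef.
- by rewrite pseries_diffs_mexp_coef; exact: cvg_mexp_coef.
- by rewrite !pseries_diffs_mexp_coef; exact: cvg_mexp_coef.
- by rewrite [ltRHS]ger0_norm// ltrDl.
Qed.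

Lemma mexpC t : A *m mexp t = mexp t *m A.
Proof. by rewrite -mexp_mulE mexp_mulC. Qed.

Lemma mderiv_mexp t : mderiv mexp t (mexp t *m A).
Proof.
have := mderiv_mexp_mul 1%:M t; rewrite mul1mx mexp_mulC.
by have -> : mexp_mul 1%:M = mexp; [apply/funext => s; rewrite mexp_mulE mul1mx|].
Qed.

Lemma mexp0 : mexp 0 = 1%:M.
Proof.
apply/matrixP => i j; rewrite mxE; apply: lim_near_cst => //.
near=> N; rewrite /pseries /series /= -[N]prednK; last by near: N.
rewrite big_nat_recl// big1 => [|k _]; last by rewrite exprS mul0r mulr0.
by rewrite addr0 /mexp_coef expr0 mul1mx fact0 divr1 mulr1 mxE.
Unshelve. all: by end_near. Qed.

Lemma mderiv_comp_opp p q (M : R -> 'M[R]_(p, q)) x M' :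
  mderiv M (- x) M' -> mderiv (fun t => M (- t)) x (- M').
Proof.
move=> dM i j; rewrite mxE.
have := @is_derive1_comp R (fun t => M t i j) -%R x _ _ (dM i j) _.
move=> /(_ (-1)); rewrite mulrN1; exact.
Qed.

Lemma mderiv_mexpN t : mderiv (fun s => mexp (- s)) t (- (mexp (- t) *m A)).
Proof. exact/mderiv_comp_opp/mderiv_mexp. Qed.

(** Any solution of [x' = A x] on an open interval is, up to the factor
    [exp (s A)], constant there. *)
Lemma mexpN_sol_cst p (x : R -> 'M[R]_(n, p)) (a b : R) :
  (forall s, a < s < b -> mderiv x s (A *m x s)) ->
  forall s s', a < s < b -> a < s' < b ->
    mexp (- s) *m x s = mexp (- s') *m x s'.
Proof.
move=> dx s s' sab s'ab; apply/matrixP => i j.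
apply: (derive0_itv_cst (f := fun s => (mexp (- s) *m x s) i j) _ sab s'ab).
move=> r rab.
have := mderivM (mderiv_mexpN r) (dx r rab).
by rewrite mulNmx mulmxA addNr => /(_ i j); rewrite mxE.
Qed.

(** On the whole line, the function [exp(- s A) x(s)] of a solution keeps its
    value at [0]; this gives uniqueness, the inverse of [exp(s A)] and the
    group law. *)
Lemma mexpN_sol p (x : R -> 'M[R]_(n, p)) :
  (forall s, mderiv x s (A *m x s)) -> forall s, mexp (- s) *m x s = x 0.
Proof.
move=> dx s.
rewrite (@mexpN_sol_cst p x (- (`|s| + 1)) (`|s| + 1) (fun s _ => dx s) s 0).
- by rewrite oppr0 mexp0 mul1mx.
- by rewrite -ltr_norml ltrDl.
- by rewrite oppr_lt0 andbb ltr_wpDl.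
Qed.

Lemma mexpNK t : mexp (- t) *m mexp t = 1%:M.
Proof.
by rewrite mexpN_sol ?mexp0// => s; rewrite mexpC; exact: mderiv_mexp.
Qed.

Lemma mexpKN t : mexp t *m mexp (- t) = 1%:M.
Proof. by have := mexpNK (- t); rewrite opprK. Qed.

Lemma mexpD s t : mexp (s + t) = mexp s *m mexp t.
Proof.
rewrite -[mexp (s + t)]mul1mx -(mexpKN s) -mulmxA; congr (_ *m _).
rewrite (@mexpN_sol _ (fun s => mexp (s + t))) ?add0r// => {}s.
rewrite mexpC => i j.
have := @is_derive1_comp R (fun t => mexp t i j) (fun s => s + t) s _ 1
  (@mderiv_mexp (s + t) i j).
rewrite mulr1; apply.
by apply: is_derive_eq; rewrite addr0.
Qed.

End MatrixExponential.
End MatrixCalculus.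

(** * Zeros of exponential polynomials and sampling *)

Section Zeros.
Variable R : realType.
Implicit Types (g h u w : R -> R) (a b c z t : R).

(** Rolle's theorem for [u / w]: its derivative is the Wronskian of [u] and [w]
    divided by [w ^ 2]. *)
Lemma wronskian_rolle u w u' w' a b : a < b ->
  (forall x : R, is_derive x (1 : R) u (u' x)) ->
  (forall x : R, is_derive x (1 : R) w (w' x)) ->
  (forall x, a <= x <= b -> 0 < w x) -> u a = 0 -> u b = 0 ->
  exists2 c, a < c < b & u' c * w c - u c * w' c = 0.
Proof.
move=> ab du dw w_gt0 ua ub.
have df x : a <= x <= b -> is_derive x (1 : R) (fun t => u t * (w t)^-1)
    ((u' x * w x - u x * w' x) / w x ^+ 2).
  move=> xab; have wx0 : w x != 0 by rewrite gt_eqF// w_gt0.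
  have dV := @is_deriveV _ w x _ 1 wx0 (dw x).
  apply: (is_derive_eq (is_deriveM (du x) dV)).
  by rewrite /GRing.scale /=; field.
have [|||c cab dc0] := @Rolle R (fun t => u t * (w t)^-1) a b ab.
- move=> x; rewrite in_itv /= => /andP[ax xb].
  by have := df x _; rewrite !ltW// => /(_ isT) ?; apply: ex_derive.
- apply: derivable_within_continuous => x; rewrite in_itv /= => xab.
  by have := df x xab => ?; apply: ex_derive.
- by rewrite ua ub !mul0r.
move: cab; rewrite in_itv /= => /andP[ac cb].
exists c; first by rewrite ac cb.
have cab : a <= c <= b by rewrite !ltW.
have := @derive_val _ _ _ _ _ _ _ (df c cab).
rewrite derive_val => /esym/eqP; rewrite mulf_eq0 invr_eq0 expf_eq0 /=.
by rewrite (gt_eqF (w_gt0 _ cab)) orbF => /eqP.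
Qed.

Lemma linear_ode_eq0 u (k : R) z :
  (forall x : R, is_derive x (1 : R) u (k * u x)) -> u z = 0 -> forall x, u x = 0.
Proof.
move=> du uz x.
have : u x * expR (- k * x) = u z * expR (- k * z).
  apply: (is_derive_0_is_cst (f := fun x => u x * expR (- k * x))) => y.
  have dy := du y; apply: is_derive_eq.
  by rewrite /GRing.scale /=; ring.
by rewrite uz mul0r => /eqP; rewrite mulf_eq0 expR_eq0 orbF => /eqP.
Qed.

(** [g] has at least [r] distinct zeros in [[a, b]], listed increasingly. *)
Definition has_zeros g a b (r : nat) : Prop :=
  exists z : nat -> R, [/\ (forall i, (i.+1 < r)%N -> z i < z i.+1),
    (forall i, (i < r)%N -> a <= z i <= b) &
    (forall i, (i < r)%N -> g (z i) = 0)].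

Lemma has_zeros_wronskian u w u' w' a b r :
  (forall x : R, is_derive x (1 : R) u (u' x)) ->
  (forall x : R, is_derive x (1 : R) w (w' x)) ->
  (forall x, a <= x <= b -> 0 < w x) ->
  has_zeros u a b r.+1 -> has_zeros (fun c => u' c * w c - u c * w' c) a b r.
Proof.
move=> du dw w_gt0 [z [zS zab uz]].
have /choice[y yP] i : exists c, (i < r)%N ->
    z i < c < z i.+1 /\ u' c * w c - u c * w' c = 0.
  have [ir|] := ltnP i r; last by exists 0.
  have /andP[azi _] := zab i (ltnW ir); have /andP[_ zib] := zab i.+1 ir.
  have w_gt0i x : z i <= x <= z i.+1 -> 0 < w x.
    move=> /andP[ix xi]; apply: w_gt0.
    by rewrite (le_trans azi) //= (le_trans xi).
  have [c] := wronskian_rolle (zS i ir) du dw w_gt0i (uz i (ltnW ir)) (uz i.+1 ir).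
  by exists c.
exists y; split=> i ir.
- have /andP[_ yi] := (yP i (ltnW ir)).1; have /andP[yi1 _] := (yP i.+1 ir).1.
  exact: lt_trans yi yi1.
- have /andP[azi _] := zab i (ltnW ir); have /andP[_ zib] := zab i.+1 ir.
  have /andP[zy yz] := (yP i ir).1.
  by rewrite (le_trans azi (ltW zy)) (le_trans (ltW yz) zib).
- exact: (yP i ir).2.
Qed.

Lemma sub_has_zeros g h a b r :
  (forall x, a <= x <= b -> g x = 0 -> h x = 0) ->
  has_zeros g a b r -> has_zeros h a b r.
Proof.
move=> gh [z [zS zab gz]]; exists z; split=> // i ir.
by apply: gh; [exact: zab|exact: gz].
Qed.

Section FirstOrder.
Variables (g g1 : R -> R) (k a b : R) (r : nat).
Hypothesis dg : forall x : R, is_derive x (1 : R) g (g1 x).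

(** The operator [D - k] loses at most one zero, by Rolle's theorem applied to
    [g / exp(k x)]. *)
Lemma has_zeros_order1 : has_zeros g a b r.+1 ->
  has_zeros (fun x => g1 x - k * g x) a b r.
Proof.
have dw x : is_derive x (1 : R) (fun x => expR (k * x)) (k * expR (k * x)).
  by apply: is_derive_eq; rewrite /GRing.scale /=; ring.
move=> /(has_zeros_wronskian dg dw (fun x _ => expR_gt0 _)).
apply: sub_has_zeros => x _ /eqP.
rewrite [X in X == 0](_ : _ = (g1 x - k * g x) * expR (k * x)); last by ring.
by rewrite mulf_eq0 expR_eq0 orbF => /eqP.
Qed.

End FirstOrder.

Section SecondOrder.
Variables (g g1 g2 : R -> R) (al be a b : R).
Hypothesis be_neq0 : be != 0.
Hypothesis be_small : `|be| * (b - a) < pi.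
Hypothesis dg : forall x : R, is_derive x (1 : R) g (g1 x).
Hypothesis dg1 : forall x : R, is_derive x (1 : R) g1 (g2 x).

Let w c x : R := expR (al * x) * cos (be * (x - c)).
Let w' c x : R :=
  expR (al * x) * (al * cos (be * (x - c)) - be * sin (be * (x - c))).
Let h x : R := g2 x - 2 * al * g1 x + (al ^+ 2 + be ^+ 2) * g x.
Let N c x : R := g1 x * w c x - g x * w' c x.

Let dw c (x : R) : is_derive x (1 : R) (w c) (w' c x).
Proof. by apply: is_derive_eq; rewrite /GRing.scale /= /w'; ring. Qed.

Let dw' c (x : R) : is_derive x (1 : R) (w' c)
  (2 * al * w' c x - (al ^+ 2 + be ^+ 2) * w c x).
Proof. by apply: is_derive_eq; rewrite /GRing.scale /= /w' /w; ring. Qed.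

Let dN c (x : R) : is_derive x (1 : R) (N c) (h x * w c x + 2 * al * N c x).
Proof.
apply: (is_derive_eq (is_deriveB (is_deriveM (dg1 x) (dw c x))
  (is_deriveM (dg x) (dw' c x)))).
by rewrite /GRing.scale /= /N /h; ring.
Qed.

Let mid := (a + b) / 2.

Let w_gt0 x : a <= x <= b -> 0 < w mid x.
Proof.
move=> /andP[ax xb]; rewrite mulr_gt0 ?expR_gt0//.
apply: cos_gt0_pihalf; rewrite -ltr_norml normrM.
have xmid : `|x - mid| <= (b - a) / 2 by rewrite ler_norml /mid; lra.
apply: le_lt_trans (ler_wpM2l (normr_ge0 _) xmid) _.
by rewrite mulrA ltr_pM2r// invr_gt0.
Qed.

(** The operator [(D - al)^2 + be^2] loses at most two zeros on an interval
    shorter than [pi / |be|].  Such an interval carries a positive solution [w]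
    of the homogeneous equation, centred at its midpoint, and the operator
    factors as two first-order ones: the Wronskian [N] of [g] and [w], then
    [N' - 2 al N = w h]. *)
Lemma has_zeros_order2 r : has_zeros g a b r.+2 -> has_zeros h a b r.
Proof.
move=> /(has_zeros_wronskian dg (dw mid) w_gt0) Nz.
have dv x : is_derive x (1 : R) (fun x => expR (2 * al * x))
    (2 * al * expR (2 * al * x)).
  by apply: is_derive_eq; rewrite /GRing.scale /=; ring.
have := has_zeros_wronskian (dN mid) dv (fun x _ => expR_gt0 _) Nz.
apply: sub_has_zeros => x xab /eqP.
rewrite [X in X == 0](_ : _ = h x * (w mid x * expR (2 * al * x))); last by ring.
rewrite mulf_eq0 => /orP[/eqP //|].
by rewrite gt_eqF// mulr_gt0 ?expR_gt0 ?w_gt0.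
Qed.

(** A solution of [(D - al)^2 g + be^2 g = 0] with two zeros in a short interval
    vanishes identically. *)
Lemma order2_eq0 : has_zeros g a b 2 -> (forall x, h x = 0) ->
  forall x, g x = 0.
Proof.
move=> gz h0.
have dN0 c (x : R) : is_derive x (1 : R) (N c) (2 * al * N c x).
  by have := dN c x; rewrite h0 mul0r add0r.
have [y [_ _ /(_ 0%N isT) Ny]] := has_zeros_wronskian dg (dw mid) w_gt0 gz.
have [z [_ /(_ 0%N isT) zab /(_ 0%N isT) gz0]] := gz.
have := linear_ode_eq0 (dN0 mid) Ny (z 0%N).
rewrite /N gz0 mul0r subr0 => /eqP.
rewrite mulf_eq0 (gt_eqF (w_gt0 zab)) orbF => /eqP g1z0.
have N0 c : forall x, N c x = 0.
  by apply: (linear_ode_eq0 (dN0 c) (z := z 0%N)); rewrite /N gz0 g1z0 !mul0r subrr.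
(* The solution w centred a quarter period before x vanishes at x, but its
   derivative does not. *)
move=> x; have := N0 (x - pi / 2 / be) x; rewrite /N /w /w'.
have -> : be * (x - (x - pi / 2 / be)) = pi / 2 by field.
rewrite cos_pihalf sin_pihalf !mulr0 sub0r sub0r mulr1 !mulrN opprK => /eqP.
by rewrite !mulf_eq0 expR_eq0 (negbTE be_neq0) !orbF => /eqP.
Qed.

End SecondOrder.

End Zeros.

Section Chebyshev.
Variables (R : realType) (n : nat) (A : 'M[R]_n.+1) (phi : 'rV[R]_n.+1).

(** The scalar output [phi exp(t A) d]. *)
Definition observed (d : 'cV[R]_n.+1) (t : R) : R := (phi *m mexp A t *m d) 0 0.

Lemma is_derive_observed d (t : R) :
  is_derive t (1 : R) (observed d) (observed (A *m d) t).
Proof.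
have dE := mderivM (mderivM (mderiv_cst phi t) (mderiv_mexp A t))
  (mderiv_cst d t).
apply: (is_derive_eq (dE 0 0)).
by rewrite mul0mx add0r mulmx0 addr0 /observed !mulmxA.
Qed.

Lemma observedD d e t : observed (d + e) t = observed d t + observed e t.
Proof. by rewrite /observed mulmxDr mxE. Qed.

Lemma observedZ k d t : observed (k *: d) t = k * observed d t.
Proof. by rewrite /observed -scalemxAr mxE. Qed.

Lemma observedN d t : observed (- d) t = - observed d t.
Proof. by rewrite /observed mulmxN mxE. Qed.

Let toC := real_complex R.

Lemma size_quadratic (al be : R) :
  size (('X - al%:P) ^+ 2 + (be ^+ 2)%:P) = 3%N.
Proof.
by rewrite size_polyDl size_exp_XsubC// size_polyC; case: (_ == 0).
Qed.

(** A real polynomial with a nonreal root is divisible by the real quadratic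
    polynomial that this root and its conjugate define. *)
Lemma quadratic_dvdp (p : {poly R}) (al be : R) : be != 0 ->
  root (map_poly toC p) (al +i* be)%C ->
  ('X - al%:P) ^+ 2 + (be ^+ 2)%:P %| p.
Proof.
move=> be0 rp; set Q := _ + _.
have sQ : size Q = 3%N by exact: size_quadratic.
have sr : (size (p %% Q)%R <= 2)%N by rewrite -ltnS -sQ ltn_modp -size_poly_gt0 sQ.
set r := (p %% Q)%R in sr *.
have : (map_poly toC r).[(al +i* be)%C] = 0.
  have -> : r = p - (p %/ Q) * Q by rewrite [X in X - _](divp_eq p Q) addrAC subrr add0r.
  rewrite rmorphB rmorphM /= hornerD hornerN hornerM (rootP rp) sub0r.
  rewrite [X in _ * X](_ : _ = 0) ?mulr0 ?oppr0//.
  rewrite rmorphD rmorphXn rmorphB /= map_polyX !map_polyC /=.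
  rewrite !hornerE; apply/eqP; rewrite eq_complex /=.
  by apply/andP; split; apply/eqP; ring.
rewrite (horner_coef_wide _ (n := 2)); last by rewrite size_map_poly.
rewrite !big_ord_recl big_ord0 /= !coef_map /= expr0 mulr1 addr0 expr1.
move=> /eqP; rewrite eq_complex /= => /andP[/eqP r0 /eqP r1].
have r1_eq0 : r`_1 = 0.
  apply/eqP; move: r1; rewrite mul0r addr0 add0r => /eqP.
  by rewrite mulf_eq0 (negbTE be0) orbF.
have r0_eq0 : r`_0 = 0 by move: r0; rewrite r1_eq0 !mul0r subr0 addr0.
apply/eqP/polyP => i; rewrite coef0.
by case: i => [|[|i]] //; rewrite nth_default// (leq_trans sr).
Qed.

(** Disconjugacy: when the roots of a polynomial annihilating [d] have small
    imaginary parts, a nonzero function [t |-> phi exp(t A) d] has fewer zeros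
    on [[a, b]] than the degree of that polynomial.  A complex root of the
    polynomial splits off a real factor of degree one or two; applying that
    factor to [A] and [d] lowers the degree and loses no more zeros than the
    degree of the factor. *)
Theorem observed_eq0 (p : {poly R}) (a b : R) (d : 'cV[R]_n.+1) :
  p != 0 ->
  (forall z : R[i], root (map_poly toC p) z ->
     `|complex.Im z| * (b - a) < pi) ->
  horner_mx A p *m d = 0 ->
  has_zeros (observed d) a b (size p).-1 ->
  forall t, observed d t = 0.
Proof.
have [k] := ubnP (size p); elim: k => // k IH in p d *.
rewrite ltnS => pk p0 proot pd dz.
have [/size1_polyC pE|p_gt1] := leqP (size p) 1.
  have c0 : p`_0 != 0 by apply: contra p0 => /eqP c0; rewrite pE c0.
  move=> t; suff -> : d = 0 by rewrite /observed mulmx0 mxE.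
  move: pd; rewrite pE horner_mx_C mul_scalar_mx => /eqP.
  by rewrite scaler_eq0 (negbTE c0) => /eqP.
have /closed_rootP[[al be] rz] : size (map_poly toC p) != 1%N.
  by rewrite size_map_poly gtn_eqF.
have dvd_root q : q %| p -> forall z : R[i], root (map_poly toC q) z ->
     `|complex.Im z| * (b - a) < pi.
  by move=> /dvdpP[u pE] z qz; apply: proot; rewrite pE rmorphM rootM qz orbT.
have [be0|be0] := eqVneq be 0.
  have /factor_theorem[q pE] : root p al.
    move: rz; rewrite be0 -[(al +i* 0)%C]/(toC al) /root horner_map.
    by rewrite -[0]/(toC 0) (inj_eq (@complexI R)).
  have q0 : q != 0 by apply: contra p0 => /eqP q0; rewrite pE q0 mul0r.
  have sp : size p = (size q).+1
    by rewrite pE size_mul ?polyXsubC_eq0// size_XsubC addn2.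
  have sq : size q = (size q).-1.+1 by rewrite prednK// size_poly_gt0.
  rewrite sp /= sq in dz.
  have h0 : forall t, observed (A *m d - al *: d) t = 0.
    apply: (IH q) => //.
    - by rewrite -ltnS -sp.
    - by apply: dvd_root; rewrite pE dvdp_mulr.
    - move: pd; rewrite pE rmorphM rmorphB /= horner_mx_X horner_mx_C.
      by rewrite -mulmxE -mulmxA mulmxBl mul_scalar_mx.
    - have := has_zeros_order1 al (is_derive_observed d) dz.
      apply: sub_has_zeros => x _.
      by rewrite observedD observedN observedZ.
  have [z [_ _ /(_ 0%N isT) dz0]] := dz.
  apply: (linear_ode_eq0 (k := al) _ dz0) => x.
  apply: (is_derive_eq (is_derive_observed d x)).
  have := h0 x; rewrite observedD observedN observedZ => /eqP.
  by rewrite subr_eq0 => /eqP.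
have /dvdpP[q pE] := quadratic_dvdp be0 rz.
set Q := _ + _ in pE.
have sQ : size Q = 3%N by exact: size_quadratic.
have q0 : q != 0 by apply: contra p0 => /eqP q0; rewrite pE q0 mul0r.
have Q0 : Q != 0 by rewrite -size_poly_gt0 sQ.
have sp : size p = (size q).+2 by rewrite pE size_mul// sQ addnC.
have sq : size q = (size q).-1.+1 by rewrite prednK// size_poly_gt0.
rewrite sp /= sq in dz.
have be_small : `|be| * (b - a) < pi by exact: (proot _ rz).
pose e := A *m (A *m d) - (2 * al) *: (A *m d) + (al ^+ 2 + be ^+ 2) *: d.
have eE t : observed e t = observed (A *m (A *m d)) t
    - 2 * al * observed (A *m d) t + (al ^+ 2 + be ^+ 2) * observed d t.
  by rewrite /e !observedD observedN !observedZ.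
have h0 : forall t, observed e t = 0.
  apply: (IH q) => //.
  - by apply: leq_trans pk; rewrite sp.
  - by apply: dvd_root; rewrite pE dvdp_mulr.
  - move: pd; rewrite pE rmorphM -mulmxE -mulmxA => <-; congr (_ *m _).
    rewrite /Q rmorphD rmorphXn rmorphB /= horner_mx_X !horner_mx_C.
    rewrite mulmxDl mul_scalar_mx expr2 -mulmxE -mulmxA !mulmxBl !mul_scalar_mx.
    rewrite mulmxBr -scalemxAr /e scalerBr scalerA -expr2 scalerDl.
    by rewrite mulr_natl mulr2n scalerDl !opprD !addrA opprK.
  - have := has_zeros_order2 al be_small (is_derive_observed d)
      (is_derive_observed (A *m d)) dz.
    by apply: sub_has_zeros => x _; rewrite eE.
apply: (order2_eq0 (al := al) be0 be_small (is_derive_observed d)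
  (is_derive_observed (A *m d)) (a := a) (b := b)).
  have [z [zS zab dz0]] := dz.
  by exists z; split=> [i i2|i i2|i i2]; [apply: zS|apply: zab|apply: dz0];
    apply: leq_trans i2 _.
by move=> x; rewrite -eE.
Qed.

(** A vector is annihilated by a polynomial in [A] whose degree is at most the
    dimension of its Krylov space. *)
Lemma krylov_annihilator (d : 'cV[R]_n.+1) :
  exists p : {poly R}, [/\ p != 0, (size p <= (\dim (krylov A d)).+1)%N &
    horner_mx A p *m d = 0].
Proof.
set r := \dim _.
(* If r > n, the characteristic polynomial, of degree n + 1, is short enough.
   Otherwise the r + 1 vectors A^l d, l <= r, all lie in the Krylov space, of
   dimension r, and are linearly dependent. *)
have [rn|nr] := leqP r n; last first.
  exists (char_poly A); split.
  - by rewrite -size_poly_gt0 size_char_poly.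
  - by rewrite size_char_poly ltnS.
  - by rewrite Cayley_Hamilton mul0mx.
pose X := [tuple A ^+ (l : 'I_r.+1) *m d | l < r.+1].
have [k [kX [i ki]]] : exists k : 'I_r.+1 -> R,
    \sum_(l < r.+1) k l *: X`_l = 0 /\ exists l, k l != 0.
  apply: contrapT => nok; suff : ~~ free X.
    move=> /negP; apply; apply/freeP => k kX l; apply: contrapT => /eqP kl.
    by apply: nok; exists k; split=> //; exists l.
  apply/negP; rewrite /free size_tuple => /eqP dimX.
  have : (\dim <<X>> <= r)%N.
    apply/dimvS/span_subvP => x /tnthP[l ->]; rewrite tnth_mktuple.
    apply/memv_span/mapP; exists (l : nat) => //.
    by rewrite mem_iota add0n leq0n (leq_trans (ltn_ord l)).
  by rewrite dimX ltnn.
exists (\poly_(l < r.+1) k (inord l)); split.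
- apply/eqP => /(congr1 (fun p : {poly R} => p`_i)).
  by rewrite coef_poly ltn_ord inord_val coef0 => /eqP; rewrite (negbTE ki).
- exact: size_poly.
- rewrite poly_def linear_sum mulmx_suml -[RHS]kX; apply: eq_bigr => l _.
  rewrite linearZ rmorphXn /= horner_mx_X inord_val -scalemxAl; congr (_ *: _).
  by rewrite (nth_mktuple (fun l : 'I_r.+1 => A ^+ l *m d)).
Qed.

(** Taking the gcd with the characteristic polynomial, the annihilator may be
    assumed to have only eigenvalues of [A] as roots. *)
Lemma krylov_annihilator_char (d : 'cV[R]_n.+1) :
  exists p : {poly R}, [/\ p != 0, (size p <= (\dim (krylov A d)).+1)%N,
    horner_mx A p *m d = 0 & p %| char_poly A].
Proof.
have [p [p0 sp pd]] := krylov_annihilator d.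
have char0 : char_poly A != 0 by rewrite -size_poly_gt0 size_char_poly.
exists (gcdp p (char_poly A)); split.
- by rewrite gcdp_eq0 (negbTE p0).
- by apply: leq_trans sp; apply: dvdp_leq => //; exact: dvdp_gcdl.
- have [[u v] /= /andP[/dvdpP[w ->] _]] := Bezoutp p (char_poly A).
  rewrite rmorphM rmorphD !rmorphM /= Cayley_Hamilton mulr0 addr0.
  by rewrite -!mulmxE -!mulmxA pd !mulmx0.
- exact: dvdp_gcdr.
Qed.

Lemma annihilator_root_spectrum (p : {poly R}) z :
  p %| char_poly A -> root (map_poly toC p) z -> spectrum A z.
Proof.
move=> /dvdpP[u uE] pz; rewrite /spectrum /= eigenvalue_root_char.
by rewrite -map_char_poly uE rmorphM rootM pz orbT.
Qed.

Lemma spectrum_lt_dA (z : R[i]) (len : R) : 0 <= len ->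
  spectrum A z -> (len%:E < dA A)%E -> `|complex.Im z| * len < pi.
Proof.
move=> len0 Az lt_len.
have [->|Imz] := eqVneq (complex.Im z) 0; first by rewrite normr0 mul0r pi_gt0.
have : (dA A <= (pi / `|complex.Im z|)%:E)%E.
  by apply: ereal_inf_lbound; exists z => //; rewrite (negbTE Imz).
move=> /(lt_le_trans lt_len); rewrite lte_fin ltr_pdivlMr ?normr_gt0//.
by rewrite mulrC.
Qed.

(** Nonpathological sampling: [q] equally spaced zeros, [q] bounding the
    dimension of the Krylov space of [d], already force the output to vanish. *)
Theorem observed_eq0_sampled (d : 'cV[R]_n.+1) (q : nat) (T t0 : R) :
  (\dim (krylov A d) <= q)%N -> 0 < T -> ((q%:R * T)%:E < dA A)%E ->
  (forall i, (i < q)%N -> observed d (t0 + i%:R * T) = 0) ->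
  forall t, observed d t = 0.
Proof.
move=> dq T0 qT dz; have [p [p0 sp pd pA]] := krylov_annihilator_char d.
apply: (observed_eq0 (a := t0) (b := t0 + q%:R * T) p0 _ pd) => [z pz|].
  rewrite addrAC subrr add0r; apply: spectrum_lt_dA qT.
    by rewrite mulr_ge0// ltW.
  exact: annihilator_root_spectrum pz.
have spq : ((size p).-1 <= q)%N by rewrite -ltnS prednK ?size_poly_gt0// (leq_trans sp).
exists (fun i => t0 + i%:R * T); split=> i ip.
- by rewrite ltrD2l ltr_pM2r// ltr_nat.
- rewrite lerDl mulr_ge0 ?(ltW T0)//= lerD2l ler_pM2r// ler_nat.
  by rewrite (leq_trans (ltnW ip)).
- by apply: dz; exact: leq_trans spq.
Qed.

End Chebyshev.

(** * Impulse instants *)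

Section Density.
Variables (R : realType) (hbar : nat) (t : nat -> R).
Hypotheses (hbar_gt0 : (0 < hbar)%N) (timest : impulse_times hbar t).

Lemma impulse_times_ltW i j : (i <= j)%N -> t i <= t j.
Proof.
case: timest => _ tS _ ij.
by rewrite -(subnK ij); elim: (j - i)%N => // k IH; rewrite addSn (le_trans IH)// ltW.
Qed.

Lemma impulse_times_period i k : t (i + k * hbar)%N = t i + k%:R * t hbar.
Proof.
case: timest => t0 tS tp.
have tp' j : t (j + hbar)%N = t j + t hbar.
  case: j => [|j]; first by rewrite t0 add0r.
  by rewrite -(tp j.+1 isT) addrC subrK.
elim: k => [|k IH]; first by rewrite mul0n addn0 mul0r addr0.
by rewrite mulSnr addnA tp' IH -addrA -[k.+1]addn1 natrD mulrDl mul1r.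
Qed.

Lemma impulse_times_period_gt0 : 0 < t hbar.
Proof.
case: timest => t0 tS _; rewrite -t0.
by apply: lt_le_trans (tS 0%N) _; exact: impulse_times_ltW.
Qed.

Lemma impulse_times_unbounded s : exists i, s <= t i.+1.
Proof.
have T0 := impulse_times_period_gt0; have [t0 tS _] := timest.
exists (0 + (Num.truncn (s / t hbar)).+1 * hbar)%N.
apply: le_trans (ltW (tS _)); rewrite impulse_times_period t0 add0r.
by rewrite -ler_pdivrMr// ltW// truncnS_gt.
Qed.

Lemma impulse_times_locate (s : R) : 0 < s -> exists i, t i < s <= t i.+1.
Proof.
move=> s0; have [i si imin] := ex_minnP (impulse_times_unbounded s).
exists i; rewrite si andbT; case: i imin {si} => [|i] imin.
  by case: timest => ->.
by rewrite ltNge; apply/negP => /imin; rewrite ltnn.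
Qed.

Lemma impulse_times_gap i : t i.+1 <= t i + t hbar.
Proof.
have := impulse_times_period i 1; rewrite mul1n mul1r => <-.
by apply: impulse_times_ltW; rewrite -addn1 leq_add2l.
Qed.

(** The density condition enters only through this bound on the period [t hbar]:
    an interval of length [dA A] contains more than [q] periods. *)
Lemma dense_times_period n k (A : 'M[R]_n) (D : 'M[R]_(n, k)) :
  dense_times hbar A D t -> (((qmax A D)%:R * t hbar)%:E < dA A)%E.
Proof.
move=> [_ /(_ 0 (lexx 0))]; set q := qmax A D => card_ge.
set N := (hbar * (q + 2))%N in card_ge.
have N0 : (0 < N)%N by rewrite muln_gt0 hbar_gt0 addn2.
(* If t N were at least dA A, the window ]0, dA A[ would contain only some of
   the N - 1 instants t 1, ..., t (N - 1). *)
suff : ((t N)%:E < dA A)%E.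
  apply: le_lt_trans; rewrite lee_fin -[leLHS]add0r.
  have -> : 0 = t 0%N by case: timest.
  rewrite -impulse_times_period; apply: impulse_times_ltW.
  by rewrite add0n mulnC leq_mul2l leq_addr orbT.
rewrite ltNge; apply/negP => dA_le.
have : (`I_N #<= `I_N.-1)%card.
  apply: card_le_trans card_ge _.
  apply: (@card_le_trans _ _ _ ((fun i => t i.+1) @` `I_N.-1)); last first.
    exact: card_image_le.
  apply: subset_card_le => x [[r0 rd] [[|j] _ tj]].
    by move: r0; rewrite -tj; case: timest => ->; rewrite ltxx.
  exists j => //=; rewrite -ltnS prednK// ltnNge; apply/negP => Nj.
  move: rd; rewrite add0e ltNge -tj => /negP; apply.
  by apply: le_trans dA_le _; rewrite lee_fin; exact: impulse_times_ltW.
by rewrite card_le_II -ltnS prednK// ltnn.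
Qed.

End Density.

(** * Linear-quadratic regulation of periodic discrete-time systems *)

Section QuadraticForms.
Variable R : realType.

(** The squared Euclidean norm. *)
Definition sqn n (v : 'cV[R]_n) : R := \sum_(i < n) v i 0 ^+ 2.

(** The bilinear form of the matrix [Q]. *)
Definition bil n (Q : 'M[R]_n) (x y : 'cV[R]_n) : R := (x^T *m Q *m y) 0 0.

(** Symmetric positive semidefinite matrices. *)
Definition psd n (Q : 'M[R]_n) : Prop := Q^T = Q /\ forall x, 0 <= bil Q x x.

Lemma sqnE n (v : 'cV[R]_n) : sqn v = bil 1%:M v v.
Proof.
by rewrite /bil mulmx1 mxE; apply: eq_bigr => i _; rewrite mxE expr2.
Qed.

Lemma sqn_ge0 n (v : 'cV[R]_n) : 0 <= sqn v.
Proof. by apply: sumr_ge0 => i _; rewrite sqr_ge0. Qed.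

Lemma sqn0 n : sqn (0 : 'cV[R]_n) = 0.
Proof. by rewrite /sqn big1 // => i _; rewrite mxE expr0n. Qed.

Lemma sqn_eq0 n (v : 'cV[R]_n) : sqn v = 0 -> v = 0.
Proof.
move=> v0; apply/colP => i; rewrite mxE; apply/eqP; rewrite -sqrf_eq0.
have /eqP := v0; rewrite psumr_eq0 => [/allP/(_ i (mem_index_enum i))//|j _].
exact: sqr_ge0.
Qed.

Lemma bilDl n (Q : 'M[R]_n) x y z : bil Q (x + y) z = bil Q x z + bil Q y z.
Proof. by rewrite /bil linearD !mulmxDl mxE. Qed.

Lemma bilDr n (Q : 'M[R]_n) x y z : bil Q x (y + z) = bil Q x y + bil Q x z.
Proof. by rewrite /bil mulmxDr mxE. Qed.

Lemma bilZl n (Q : 'M[R]_n) k x y : bil Q (k *: x) y = k * bil Q x y.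
Proof. by rewrite /bil linearZ -!scalemxAl mxE. Qed.

Lemma bilZr n (Q : 'M[R]_n) k x y : bil Q x (k *: y) = k * bil Q x y.
Proof. by rewrite /bil -scalemxAr mxE. Qed.

Lemma bil_suml n (Q : 'M[R]_n) I (r : seq I) f y :
  bil Q (\sum_(i <- r) f i) y = \sum_(i <- r) bil Q (f i) y.
Proof. by rewrite /bil linear_sum /= !mulmx_suml summxE. Qed.

Lemma bil_sumr n (Q : 'M[R]_n) I (r : seq I) f x :
  bil Q x (\sum_(i <- r) f i) = \sum_(i <- r) bil Q x (f i).
Proof. by rewrite /bil mulmx_sumr summxE. Qed.

Lemma bil_addm n (P Q : 'M[R]_n) x y : bil (P + Q) x y = bil P x y + bil Q x y.
Proof. by rewrite /bil mulmxDr mulmxDl mxE. Qed.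

Lemma bil_oppm n (Q : 'M[R]_n) x y : bil (- Q) x y = - bil Q x y.
Proof. by rewrite /bil mulmxN mulNmx mxE. Qed.

Lemma bil_congr n p (Q : 'M[R]_n) (M : 'M[R]_(n, p)) x y :
  bil (M^T *m Q *m M) x y = bil Q (M *m x) (M *m y).
Proof. by rewrite /bil trmx_mul !mulmxA. Qed.

Lemma bilC n (Q : 'M[R]_n) x y : Q^T = Q -> bil Q x y = bil Q y x.
Proof.
move=> sQ; rewrite /bil -[in RHS]sQ -[in LHS](trmxK x).
have -> (z : 'M[R]_1) : z 0 0 = z^T 0 0 by rewrite mxE.
by rewrite !trmx_mul !trmxK mulmxA.
Qed.

Lemma psd1 n : psd (1%:M : 'M[R]_n).
Proof. by split=> [|x]; rewrite ?trmx1// -sqnE sqn_ge0. Qed.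

Lemma psdD n (P Q : 'M[R]_n) : psd P -> psd Q -> psd (P + Q).
Proof.
move=> [sP P0] [sQ Q0]; split=> [|x]; first by rewrite linearD /= sP sQ.
by rewrite bil_addm addr_ge0.
Qed.

Lemma psd_congr n p (Q : 'M[R]_n) (M : 'M[R]_(n, p)) :
  psd Q -> psd (M^T *m Q *m M).
Proof.
move=> [sQ Q0]; split=> [|x]; last by rewrite bil_congr.
by rewrite !trmx_mul trmxK sQ mulmxA.
Qed.

Lemma col_sum_delta n (x : 'cV[R]_n) : x = \sum_i x i 0 *: delta_mx i 0.
Proof.
rewrite [LHS]matrix_sum_delta; apply: eq_bigr => i _.
by rewrite big_ord1.
Qed.

(** A positive semidefinite form is bounded by its trace, up to the dimension:
    [2 x_i x_j Q_ij <= x_i^2 Q_ii + x_j^2 Q_jj]. *)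
Lemma psd_le_trace n (Q : 'M[R]_n) x : psd Q ->
  bil Q x x <= n%:R * (\sum_i bil Q (delta_mx i 0) (delta_mx i 0)) * sqn x.
Proof.
move=> [sQ Q0]; pose q i := bil Q (delta_mx i 0) (delta_mx i 0).
have bilE : bil Q x x =
    \sum_i \sum_j x i 0 * x j 0 * bil Q (delta_mx i 0) (delta_mx j 0).
  rewrite {1 2}(col_sum_delta x) bil_suml; apply: eq_bigr => i _.
  by rewrite bil_sumr; apply: eq_bigr => j _; rewrite bilZl bilZr mulrA.
have termP i j : x i 0 * x j 0 * bil Q (delta_mx i 0) (delta_mx j 0) <=
    (x i 0 ^+ 2 * q i + x j 0 ^+ 2 * q j) / 2.
  have := Q0 (x i 0 *: delta_mx i 0 + - x j 0 *: delta_mx j 0).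
  rewrite !bilDl !bilDr !bilZl !bilZr (bilC (delta_mx j 0) _ sQ) -/(q i) -/(q j).
  by move=> ?; nra.
have -> : n%:R * (\sum_i q i) * sqn x = n%:R * \sum_i x i 0 ^+ 2 * \sum_j q j.
  by rewrite -mulr_suml mulrAC mulrA.
apply: (@le_trans _ _ (n%:R * \sum_i x i 0 ^+ 2 * q i)).
  rewrite bilE.
  apply: (@le_trans _ _
      (\sum_i \sum_j (x i 0 ^+ 2 * q i + x j 0 ^+ 2 * q j) / 2)).
    by apply: ler_sum => i _; apply: ler_sum => j _.
  under eq_bigr do rewrite -mulr_suml big_split /= sumr_const card_ord.
  rewrite -mulr_suml big_split /= sumr_const card_ord sumrMnl.
  by rewrite -[_ *+ n]mulr_natl; lra.
rewrite ler_wpM2l ?ler0n//; apply: ler_sum => i _.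
rewrite ler_wpM2l ?sqr_ge0// (bigD1 i)//= lerDl.
by apply: sumr_ge0 => j _; exact: Q0.
Qed.

Lemma sqn_mulmx_bound n p (M : 'M[R]_(p, n)) :
  exists2 c : R, 0 <= c & forall x, sqn (M *m x) <= c * sqn x.
Proof.
have psdM : psd (M^T *m 1%:M *m M) by apply/psd_congr/psd1.
exists (n%:R * \sum_i bil (M^T *m 1%:M *m M) (delta_mx i 0) (delta_mx i 0)).
  by rewrite mulr_ge0// sumr_ge0// => i _; exact: psdM.2.
by move=> x; rewrite sqnE -bil_congr; exact: psd_le_trace.
Qed.

(** Definite forms are nondegenerate. *)
Lemma posdef_unitmx n (S : 'M[R]_n) :
  (forall v : 'cV[R]_n, bil S v v = 0 -> v = 0) -> S \in unitmx.
Proof.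
move=> Spos; rewrite -row_free_unit -kermx_eq0; apply/rowV0P => v.
move=> /sub_kermxP vS; apply: trmx_inj; rewrite trmx0; apply: Spos.
by rewrite /bil trmxK vS mul0mx mxE.
Qed.

End QuadraticForms.

Section Riccati.
Variables (R : realType) (n m : nat) (B : 'M[R]_(n, m)) (Q : 'M[R]_n).
Hypothesis psdQ : psd Q.

(** The gain of the control [u = K x] that minimises
    [|x|^2 + |u|^2 + Q(x + B u)]. *)
Definition riccati_gain : 'M[R]_(m, n) :=
  - (invmx (1%:M + B^T *m Q *m B) *m B^T *m Q).

(** The matrix of the minimal value of that cost, as a quadratic form in [x]. *)
Definition riccati : 'M[R]_n :=
  1%:M + riccati_gain^T *m 1%:M *m riccati_gain +
  (1%:M + B *m riccati_gain)^T *m Q *m (1%:M + B *m riccati_gain).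

Lemma psd_riccati : psd riccati.
Proof.
by apply: psdD; [apply: psdD; [exact: psd1|]|]; apply: psd_congr => //; exact: psd1.
Qed.

Lemma riccatiE x : bil riccati x x =
  sqn x + sqn (riccati_gain *m x) +
  bil Q (x + B *m (riccati_gain *m x)) (x + B *m (riccati_gain *m x)).
Proof.
rewrite !bil_addm -sqnE !bil_congr -sqnE.
by rewrite mulmxDl mul1mx mulmxA.
Qed.

(** Optimality of the gain, by completion of the square. *)
Lemma riccati_le x u :
  bil riccati x x <= sqn x + sqn u + bil Q (x + B *m u) (x + B *m u).
Proof.
rewrite riccatiE; set K := riccati_gain; set S := 1%:M + B^T *m Q *m B.
have [sQ Q0] := psdQ.
have uS : S \in unitmx.
  apply: posdef_unitmx => v; rewrite bil_addm -sqnE bil_congr => /eqP.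
  by rewrite paddr_eq0 ?sqn_ge0// => /andP[/eqP/sqn_eq0].
have [v ->] : exists v, u = K *m x + v.
  by exists (u - K *m x); rewrite addrC subrK.
have [y yE] : exists y, y = x + B *m (K *m x) by eexists.
rewrite -yE.
have -> : x + B *m (K *m x + v) = y + B *m v by rewrite yE mulmxDr addrA.
rewrite [sqn (_ + _)]sqnE !(bilDl, bilDr) -!sqnE (bilC (B *m v) y sQ).
rewrite (bilC v (K *m x) (trmx1 _ _)).
suff cross : bil 1%:M (K *m x) v + bil Q y (B *m v) = 0.
  by have := sqn_ge0 v; have := Q0 (B *m v); lra.
rewrite (bilC (K *m x) v (trmx1 _ _)) (bilC y (B *m v) sQ) /bil trmx_mul.
rewrite mulmx1 -!mulmxA.
have -> : B^T *m (Q *m y) = - (K *m x).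
  have SK : S *m (K *m x) = - (B^T *m Q *m x).
    by rewrite /K /riccati_gain -/S mulNmx mulmxN -!mulmxA mulKVmx.
  have : S *m (K *m x) = K *m x + B^T *m Q *m (B *m (K *m x)).
    by rewrite mulmxDl mul1mx !mulmxA.
  rewrite SK yE !mulmxDr !mulmxA => e; apply/eqP.
  by rewrite -addr_eq0 -addrA [_ + K *m x]addrC -e subrr.
by rewrite mulmxN [X in _ + X]mxE subrr.
Qed.

End Riccati.

Section PeriodicRegulator.
Variables (R : realType) (n m per : nat).
Variables (E : nat -> 'M[R]_n) (b : nat -> 'M[R]_(n, m)).
Hypothesis per_gt0 : (0 < per)%N.
Hypothesis E_per : forall i, E (i + per)%N = E i.
Hypothesis b_per : forall i, b (i + per)%N = b i.

Let step i (x : 'cV[R]_n) (u : 'cV[R]_m) : 'cV[R]_n := E i *m (x + b i *m u).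

(** The states of [x_(l+1) = E_l (x_l + b_l u_l)], started from [x] at phase [i];
    the control [u] is indexed by the number [l] of steps since the start. *)
Fixpoint trajectory (i : nat) (x : 'cV[R]_n) (u : nat -> 'cV[R]_m) (l : nat) :=
  if l is l'.+1 then
    E (i + l') *m (trajectory i x u l' + b (i + l') *m u l')
  else x.

(** The matrix of the value function with horizon [N], started at phase [i], of
    the running cost [|x|^2 + |u|^2] and zero terminal cost. *)
Fixpoint value (N i : nat) : 'M[R]_n :=
  if N is N'.+1 then
    riccati (b i) ((E i)^T *m value N' i.+1 *m E i)
  else 0.

(** The optimal gain of the first of [N + 1] steps. *)
Definition gain (N i : nat) : 'M[R]_(m, n) :=
  riccati_gain (b i) ((E i)^T *m value N i.+1 *m E i).

Let V N i x := bil (value N i) x x.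

Lemma psd_value N i : psd (value N i).
Proof.
elim: N i => [|N IH] i /=; last exact/psd_riccati/psd_congr.
by split=> [|x]; rewrite ?trmx0// /bil mulmx0 mul0mx mxE.
Qed.

Lemma value_succ N i x : V N.+1 i x =
  sqn x + sqn (gain N i *m x) + V N i.+1 (step i x (gain N i *m x)).
Proof. by rewrite /V /= riccatiE bil_congr. Qed.

(** Dynamic programming inequality. *)
Lemma value_le N i x u :
  V N.+1 i x <= sqn x + sqn u + V N i.+1 (step i x u).
Proof.
by rewrite /V /= /step -bil_congr; apply/riccati_le/psd_congr/psd_value.
Qed.

Lemma value_leS N i x : V N i x <= V N.+1 i x.
Proof.
elim: N i x => [|N IH] i x.
  by rewrite /V {1}/bil mulmx0 mul0mx mxE; exact: (psd_value _ _).2.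
rewrite (value_succ N.+1); apply: le_trans (value_le _ _ _ (gain N.+1 i *m x)) _.
by rewrite lerD2l.
Qed.

Lemma value_mono N N' i x : (N <= N')%N -> V N i x <= V N' i x.
Proof.
move=> /subnK <-; elim: (N' - N)%N => // k IH.
by rewrite addSn (le_trans IH)// value_leS.
Qed.

Lemma value_per N i : value N (i + per) = value N i.
Proof. by elim: N i => //= N IH i; rewrite b_per E_per -addSn IH. Qed.

Lemma gain_per N i : gain N (i + per) = gain N i.
Proof. by rewrite /gain b_per E_per -addSn value_per. Qed.

Lemma value_mulper N i k : value N (i + k * per) = value N i.
Proof.
by elim: k => [|k IH]; rewrite ?mul0n ?addn0// mulSn addnCA addnC value_per.
Qed.

Lemma value_trajectory N L i x u : V (L + N) i x <=
  \sum_(l < L) (sqn (trajectory i x u l) + sqn (u l)) +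
  V N (i + L) (trajectory i x u L).
Proof.
elim: L N => [|L IH] N; first by rewrite big_ord0 add0r addn0.
rewrite addSnnS (le_trans (IH _))// big_ord_recr /= -addrA lerD2l addnS.
exact: value_le.
Qed.

Section Bound.
Variables (a : R) (p : nat).
Hypothesis a_ge0 : 0 <= a.
Hypothesis p_gt0 : (0 < p)%N.
Hypothesis contraction : forall x, exists u : nat -> 'cV[R]_m,
  \sum_(l < p * per) (sqn (trajectory 0 x u l) + sqn (u l)) <= a * sqn x /\
  sqn (trajectory 0 x u (p * per)) <= 2^-1 * sqn x.

(** If a control of bounded cost halves the squared norm of the state over [p]
    periods, repeating it bounds the value functions uniformly in the horizon. *)
Lemma value_bound0 N x : V N 0 x <= 2 * a * sqn x.
Proof.
have VrL r : V (r * (p * per)) 0 x <= 2 * a * sqn x.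
  elim: r x => [|r IH] x.
    by rewrite mul0n /V /bil mulmx0 mul0mx mxE !mulr_ge0// sqn_ge0.
  have [u [cu su]] := contraction x.
  rewrite mulSn (le_trans (value_trajectory _ _ _ _ u))//.
  rewrite /V value_mulper.
  rewrite (le_trans (lerD cu (IH _)))//.
  by have := ler_wpM2l a_ge0 su; lra.
apply: le_trans (VrL N); apply: value_mono.
by rewrite leq_pmulr// muln_gt0 p_gt0.
Qed.

(** From any phase, coasting until the beginning of a later period reduces to
    the previous bound. *)
Lemma value_bound i : exists2 c : R, 0 <= c &
  forall N x, V N i x <= c * sqn x.
Proof.
have back k j : (exists2 c : R, 0 <= c & forall N x, V N (j + k) x <= c * sqn x) ->
    exists2 c : R, 0 <= c & forall N x, V N j x <= c * sqn x.
  elim: k j => [|k IH] j; first by rewrite addn0.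
  rewrite addnS -addSn => /IH[c c0 cV].
  have [e e0 eE] := sqn_mulmx_bound (E j).
  exists (1 + c * e); first by rewrite addr_ge0// mulr_ge0.
  move=> N x; apply: le_trans (value_leS _ _ _) _.
  apply: le_trans (value_le N j x 0) _.
  rewrite sqn0 addr0 mulrDl mul1r lerD2l /step mulmx0 addr0.
  by rewrite (le_trans (cV _ _))// -mulrA ler_wpM2l.
apply: (back (i * per.-1)%N).
exists (2 * a); first by rewrite mulr_ge0.
move=> N x; have -> : (i + i * per.-1 = 0 + i * per)%N.
  by rewrite -mulnS prednK.
by rewrite /V value_mulper; exact: value_bound0.
Qed.

Lemma value_bound_unif : exists2 c : R, 0 < c &
  forall N i x, V N i x <= c * sqn x.
Proof.
have /choice[c cP] (k : 'I_per) : exists c : R, 0 <= c /\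
    forall N x, V N k x <= c * sqn x.
  by have [c c0 cV] := value_bound k; exists c.
exists (1 + \sum_k c k).
  by rewrite ltr_wpDr// sumr_ge0// => k _; exact: (cP k).1.
move=> N i x; have ip : (i %% per < per)%N by rewrite ltn_pmod.
rewrite /V (divn_eq i per) addnC value_mulper.
rewrite (le_trans ((cP (Ordinal ip)).2 N x))// ler_wpM2r ?sqn_ge0//.
rewrite (bigD1 (Ordinal ip))//= addrCA lerDl addr_ge0// sumr_ge0// => k _.
exact: (cP k).1.
Qed.

(** By monotonicity and boundedness, the value functions of two consecutive
    horizons are close, at all phases, for a suitable horizon: the sum over the
    horizons of the traces of their differences is bounded. *)
Lemma value_almost_stationary : exists2 N : nat, (0 < N)%N &
  forall i x, V N.+1 i x - V N i x <= 2^-1 * sqn x.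
Proof.
have [c c0 cV] := value_bound_unif.
pose e (j : 'I_n) : 'cV[R]_n := delta_mx j 0.
pose D N i := value N.+1 i - value N i.
have DE N i x : bil (D N i) x x = V N.+1 i x - V N i x.
  by rewrite /D bil_addm bil_oppm.
have psdD N i : psd (D N i).
  split=> [|x]; last by rewrite DE subr_ge0 value_leS.
  by rewrite linearB; congr (_ - _); exact: (psd_value _ _).1.
pose gap N := \sum_(k < per) \sum_j bil (D N k) (e j) (e j).
have gap_ge0 N : 0 <= gap N by do 2! apply: sumr_ge0 => ? _; exact: (psdD _ _).2.
have sum_gap M : \sum_(N < M) gap N <= \sum_(k < per) \sum_j c * sqn (e j).
  rewrite /gap exchange_big; apply: ler_sum => k _.
  rewrite exchange_big; apply: ler_sum => j _ /=.
  under eq_bigr do rewrite DE.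
  rewrite -(big_mkord xpredT (fun N => V N.+1 k (e j) - V N k (e j))).
  rewrite telescope_sumr// (le_trans _ (cV M k (e j)))//.
  by rewrite gerBl; exact: (psd_value _ _).2.
set C := \sum_(k < per) _ in sum_gap.
(* psd_le_trace costs a factor n. *)
pose eps : R := (2 * n.+1%:R)^-1.
have eps0 : 0 < eps by rewrite invr_gt0 mulr_gt0.
(* Otherwise the first M + 1 gaps would add up to more than C. *)
have [N N0 gapN] : exists2 N, (0 < N)%N & gap N <= eps.
  apply: contrapT => nogap.
  pose M := (Num.truncn (C / eps)).+1.
  have : M%:R * eps <= C.
    apply: le_trans (sum_gap M.+1); rewrite big_ord_recl ler_wpDl//.
    rewrite mulr_natl -[M in _ *+ M]card_ord -sumr_const.
    apply: ler_sum => N _; rewrite leNgt; apply/negP => /ltW gapN.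
    by apply: nogap; exists (bump 0 N).
  rewrite leNgt => /negP; apply; rewrite -ltr_pdivrMr//.
  exact: truncnS_gt.
exists N => // i x; rewrite -DE.
have -> : D N i = D N (i %% per)%N.
  by rewrite /D [in LHS](divn_eq i per) addnC !value_mulper.
have ip : (i %% per < per)%N by rewrite ltn_pmod.
apply: le_trans (psd_le_trace x (psdD _ _)) _; rewrite ler_wpM2r ?sqn_ge0//.
have trace_le : \sum_j bil (D N (i %% per)%N) (e j) (e j) <= eps.
  apply: le_trans gapN; rewrite /gap (bigD1 (Ordinal ip))//= lerDl.
  by do 2! apply: sumr_ge0 => ? _; exact: (psdD _ _).2.
apply: le_trans (ler_wpM2l (ler0n _ _) trace_le) _.
rewrite /eps invfM mulrCA ler_piMr ?invr_ge0//.
by rewrite ler_pdivrMr ?ltr0n// mul1r ler_nat.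
Qed.

(** A receding-horizon feedback is periodic and memoryless, and the value
    function of a suitable horizon is a Lyapunov function for it. *)
Theorem periodic_lyapunov_feedback :
  exists (F : nat -> 'M[R]_(m, n)) (W : nat -> 'cV[R]_n -> R) (c : R),
  [/\ 0 < c, forall i, F (i + per)%N = F i,
      forall i x, sqn x <= W i x <= c * sqn x &
      forall i x, W i.+1 (E i *m (x + b i *m (F i *m x))) <=
        W i x - 2^-1 * sqn x].
Proof.
have [c c0 cV] := value_bound_unif.
have [N N0 NV] := value_almost_stationary.
(* The gain is that of horizon N + 1, the Lyapunov function that of horizon N,
   which dominates sqn because N > 0. *)
exists (gain N), (V N), c; split=> // [i|i x|i x].
- exact: gain_per.
- rewrite cV andbT -(prednK N0) value_succ -addrA lerDl addr_ge0 ?sqn_ge0//.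
  exact: (psd_value _ _).2.
- have := NV i x; rewrite value_succ /step.
  by have := sqn_ge0 (gain N i *m x); lra.
Qed.

End Bound.
End PeriodicRegulator.

(** * Solutions of the impulsive closed-loop system *)

Section Flow.
Variable R : realType.

(** Between two impulses a solution is the exponential flow of its right limit
    at the first one. *)
Lemma mexp_flow n (A : 'M[R]_n) (x : R -> 'cV[R]_n) (a b : R) (xp : 'cV[R]_n) :
  a < b -> (forall s, a < s < b -> is_derive s (1 : R) x (A *m x s)) ->
  x @ a^'+ --> xp -> x @ b^'- --> x b ->
  forall s, a < s <= b -> x s = mexp A (s - a) *m xp.
Proof.
move=> ab dx xa xb.
pose c := (a + b) / 2.
have cab : a < c < b by rewrite /c; apply/andP; split; lra.
pose k := mexp A (- c) *m x c; pose f s := mexp A s *m k.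
have fc s : f @ s --> f s.
  exact: (mderiv_cvg (mderivM (mderiv_mexp A s) (mderiv_cst k s))).
have xf s : a < s < b -> x s = f s.
  move=> sab; rewrite /f /k -(mexpN_sol_cst _ sab cab).
    by rewrite mulmxA mexpKN mul1mx.
  by move=> r rab; apply/is_derive_mderiv/dx.
have xpE : xp = f a.
  apply: (cvg_unique (@norm_hausdorff _ _) xa); apply: cvg_trans (cvg_at_right_filter (fc a)).
  apply: near_eq_cvg; near=> s; apply/esym/xf/andP; split; near: s.
    exact: nbhs_right_gt.
  exact: nbhs_right_lt.
have xbE : x b = f b.
  apply: (cvg_unique (@norm_hausdorff _ _) xb); apply: cvg_trans (cvg_at_left_filter (fc b)).
  apply: near_eq_cvg; near=> s; apply/esym/xf/andP; split; near: s.
    exact: nbhs_left_gt.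
  exact: nbhs_left_lt.
have fE s : f s = mexp A (s - a) *m xp.
  by rewrite xpE /f mulmxA -mexpD subrK.
move=> s /andP[as_]; rewrite le_eqVlt => /predU1P[->|sb]; rewrite -fE//.
by apply: xf; rewrite as_.
Unshelve. all: by end_near. Qed.


Section NearEq.
Variables (n : nat) (f g : R -> 'cV[R]_n) (s : R) (l : 'cV[R]_n).
Hypothesis fl : f @ s --> l.

Lemma cvg_at_left_near : (\forall r \near s^'-, f r = g r) -> g @ s^'- --> l.
Proof.
by move=> fg; apply: cvg_trans (cvg_at_left_filter fl); exact: near_eq_cvg.
Qed.

Lemma cvg_at_right_near : (\forall r \near s^'+, f r = g r) -> g @ s^'+ --> l.
Proof.
by move=> fg; apply: cvg_trans (cvg_at_right_filter fl); exact: near_eq_cvg.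
Qed.

Lemma cvg_within_near (D : set R) : (\forall r \near s, f r = g r) ->
  g @ within D (nbhs s) --> l.
Proof.
move=> fg; apply: cvg_within_filter.
by apply: cvg_trans fl; exact: near_eq_cvg.
Qed.

End NearEq.

Section ImpulsiveSystem.
Variables (n m hbar : nat) (A : 'M[R]_n).
Variables (B : 'I_hbar -> 'M[R]_(n, m)) (F : 'I_hbar -> 'M[R]_(m, n)).
Variable t : nat -> R.
Hypotheses (hbar_gt0 : (0 < hbar)%N) (timest : impulse_times hbar t).

(** The index of the matrix acting at the impulse instant [t i.+1]. *)
Definition phase (i : nat) : 'I_hbar := Ordinal (ltn_pmod i hbar_gt0).

Lemma phaseE i : (phase i).+1 = vartheta hbar i.+1.
Proof. by rewrite varthetaE. Qed.

Let t0 : t 0%N = 0. Proof. by case: timest. Qed.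
Let tS i : t i < t i.+1. Proof. by case: timest. Qed.
Let t_le i j : (i <= j)%N -> t i <= t j.
Proof. exact: (impulse_times_ltW timest). Qed.

Let between_notin i s : t i < s < t i.+1 -> ~ range t s.
Proof.
move=> /andP[is_ si] [j _ tj]; have [ji|ij] := leqP j i.
  by have := t_le ji; rewrite tj leNgt is_.
by have := t_le ij; rewrite tj leNgt si.
Qed.

Lemma closed_loop_flow x : closed_loop_solution A B F t x ->
  forall i s, t i.+1 < s <= t i.+2 ->
    x s = mexp A (s - t i.+1) *m
      (x (t i.+1) + B (phase i) *m (F (phase i) *m x (t i.+1))).
Proof.
move=> [xl _ dx jump] i; have [xp xpE jmp] := jump i.+1 (phase i) isT (phaseE i).
have -> : x (t i.+1) + B (phase i) *m (F (phase i) *m x (t i.+1)) = xp.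
  by rewrite mulmxA -jmp addrC subrK.
apply: mexp_flow => //.
- move=> s sti; apply: dx; last exact: between_notin sti.
  by case/andP: sti => + _; rewrite -t0 => /ltW; apply: le_trans; exact: t_le.
- by apply: xl; rewrite -t0; apply: le_lt_trans (tS i.+1); exact: t_le.
Qed.

(** Before the first impulse no jump occurs, the instant [t 0 = 0] not being an
    impulse. *)
Lemma closed_loop_flow0 x : closed_loop_solution A B F t x ->
  forall s : R, 0 <= s <= t 1%N -> x s = mexp A s *m x 0.
Proof.
move=> [xl xc dx _] s /andP[]; rewrite le_eqVlt => /predU1P[<- _|s0 st].
  by rewrite mexp0 mul1mx.
rewrite -[in mexp A s](subr0 s).
apply: (@mexp_flow _ A x 0 (t 1%N)); rewrite ?s0//.
- by rewrite -{1}t0; exact: tS.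
- move=> r /andP[r0 rt]; apply: dx; first exact: ltW.
  by apply: (@between_notin 0%N); rewrite t0 r0.
- have /(xc _ (lexx 0)) x0 : forall j, (0 < j)%N -> (0 : R) != t j.
    move=> j j0; apply/eqP => tj.
    by have := tS j.-1; rewrite prednK// -tj -t0 ltNge t_le.
  apply: cvg_trans x0; apply: cvg_app; apply: within_subset.
  by move=> r /ltW.
- by apply: xl; rewrite -{1}t0; exact: tS.
Qed.

Section Existence.
Variable y : 'cV[R]_n.

(** The state just after the impulse at [t i] ([y] itself for [i = 0]). *)
Fixpoint post (i : nat) : 'cV[R]_n :=
  if i is i'.+1 then
    let w := mexp A (t i'.+1 - t i') *m post i' in
    w + B (phase i') *m F (phase i') *m w
  else y.

(* The arc of the solution on ]t i, t i.+1]. *)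
Let arc i s : 'cV[R]_n := mexp A (s - t i) *m post i.

Let after s : nat := ex_minn (impulse_times_unbounded hbar_gt0 timest s).

(** The closed-loop solution with initial state [y].  For [s > 0], [after s] is
    the index [i] with [t i < s <= t i.+1]; it is [0] for [s <= 0]. *)
Definition impulsive_solution (s : R) : 'cV[R]_n := arc (after s) s.

Let solE i s : t i < s <= t i.+1 -> impulsive_solution s = arc i s.
Proof.
move=> /andP[is_ si]; rewrite /impulsive_solution /after.
case: ex_minnP => j sj jmin.
have -> // : j = i; apply/eqP; rewrite eqn_leq jmin//= leqNgt.
by apply/negP => ji; move: (lt_le_trans is_ sj); rewrite ltNge t_le.
Qed.

Let solE0 s : s <= t 1%N -> impulsive_solution s = arc 0 s.
Proof.
move=> st; rewrite /impulsive_solution /after.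
by case: ex_minnP => j _ /(_ _ st); rewrite leqn0 => /eqP ->.
Qed.

Let locate (s : R) : 0 < s -> exists i, t i < s <= t i.+1.
Proof. exact: (impulse_times_locate hbar_gt0 timest). Qed.

Let is_derive_arc i (s : R) : is_derive s (1 : R) (arc i) (A *m arc i s).
Proof.
apply/is_derive_mderiv.
have dshift : mderiv (fun r => mexp A (r - t i)) s (mexp A (s - t i) *m A).
  move=> k l.
  have := @is_derive1_comp R (fun r => mexp A r k l) (fun r => r - t i) s _ 1
    (mderiv_mexp A (s - t i) k l).
  rewrite mulr1; apply.
  by apply: is_derive_eq; rewrite oppr0 addr0.
have := mderivM dshift (mderiv_cst (post i) s).
by rewrite mulmx0 addr0 -mexpC -mulmxA.
Qed.

Let arc_cvg i (s : R) : arc i @ s --> arc i s.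
Proof. exact/mderiv_cvg/is_derive_mderiv/is_derive_arc. Qed.

Lemma impulsive_solution0 : impulsive_solution 0 = y.
Proof.
rewrite solE0 ?/arc ?t0 ?subrr ?mexp0 ?mul1mx//.
by rewrite -[leLHS]t0 ltW.
Qed.

Lemma impulsive_solutionP : closed_loop_solution A B F t impulsive_solution.
Proof.
have near_arc i s : t i < s < t i.+1 ->
    \forall r \near s, arc i r = impulsive_solution r.
  move=> /andP[is_ si]; near=> r; apply/esym/solE/andP; split.
    by near: r; exact: lt_nbhsr.
  by apply: ltW; near: r; exact: lt_nbhsl.
split.
- move=> s s0; have [i /andP[is_ si]] := locate s0.
  rewrite (solE (i := i)) ?is_//.
  apply: (cvg_at_left_near (@arc_cvg i s)).
  near=> r; apply/esym/solE/andP; split; last apply: le_trans si.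
    by near: r; exact: nbhs_left_gt.
  by apply: ltW; near: r; exact: nbhs_left_lt.
- move=> s; rewrite le_eqVlt => /predU1P[<- _|s0 st].
    rewrite solE0; last by rewrite -[leLHS]t0 ltW.
    apply: (cvg_within_near (@arc_cvg 0 0)).
    near=> r; apply/esym/solE0.
    by apply: ltW; near: r; apply: lt_nbhsl; rewrite -[ltLHS]t0.
  have [i /andP[is_ si]] := locate s0.
  rewrite (solE (i := i)) ?is_//.
  apply: (cvg_within_near (@arc_cvg i s)); apply: near_arc.
  by rewrite is_ lt_neqAle st.
- move=> s s0 srange.
  have {}s0 : 0 < s.
    rewrite lt_neqAle s0 andbT; apply/eqP => s0E.
    by apply: srange; exists 0%N; rewrite // t0.
  have [i /andP[is_ si]] := locate s0.
  rewrite (solE (i := i)) ?is_//.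
  apply: near_eq_is_derive (is_derive_arc i s); apply: near_arc.
  rewrite is_ lt_neqAle si andbT; apply/eqP => sE.
  by apply: srange; exists i.+1.
- move=> [//|i] k _ kE; exists (post i.+1).
    have -> : post i.+1 = arc i.+1 (t i.+1) by rewrite /arc subrr mexp0 mul1mx.
    apply: (cvg_at_right_near (@arc_cvg i.+1 (t i.+1))).
    near=> r; apply/esym/solE/andP; split.
      by near: r; exact: nbhs_right_gt.
    by apply: ltW; near: r; exact: nbhs_right_lt.
  have -> : k = phase i by apply/val_inj/succn_inj; rewrite kE -phaseE.
  rewrite (solE (i := i)) ?tS ?lexx// /= -/(arc i (t i.+1)).
  by rewrite addrAC subrr add0r.
Unshelve. all: by end_near. Qed.

(** Modulo the controllable subspace, that is after multiplication by any [phi]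
    that annihilates all [exp(s A) B_k], the impulses have no effect. *)
Lemma impulsive_solution_mod p (phi : 'M[R]_(p, n)) :
  (forall s k, phi *m mexp A s *m B k = 0) ->
  forall s : R, 0 <= s -> phi *m impulsive_solution s = phi *m mexp A s *m y.
Proof.
move=> phi0.
have postE i s : phi *m mexp A s *m post i = phi *m mexp A (s + t i) *m y.
  elim: i s => [|i IH] s /=; first by rewrite t0 addr0.
  rewrite mulmxDr !mulmxA phi0 !mul0mx addr0 -[phi *m _ *m _]mulmxA -mexpD.
  by rewrite IH -addrA subrK.
move=> s; rewrite le_eqVlt => /predU1P[<-|s0].
  by rewrite impulsive_solution0 mexp0 mulmx1.
have [i isi] := locate s0.
by rewrite (solE isi) /arc mulmxA postE subrK.
Qed.

End Existence.
End ImpulsiveSystem.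

Lemma sqn_enorm n (v : 'cV[R]_n) : sqn v = enorm v ^+ 2.
Proof. by rewrite /enorm sqr_sqrtr ?sqn_ge0. Qed.

Lemma enorm_ge0 n (v : 'cV[R]_n) : 0 <= enorm v.
Proof. exact: sqrtr_ge0. Qed.

(** The only consequence of stabilizability that is needed: modulo the
    controllable subspace, [exp(s A) y] is as small as desired for large [s]. *)
Lemma pair_stabilizable_decay n m hbar (A : 'M[R]_n)
    (B : 'I_hbar -> 'M[R]_(n, m)) (eps : R) :
  (0 < hbar)%N -> 0 < eps -> pair_stabilizable A B ->
  exists2 s0 : R, 0 <= s0 & forall s, s0 <= s -> forall y : 'cV[R]_n,
    exists2 z : 'cV[R]_n, sqn z <= eps * sqn y &
      forall p (phi : 'M[R]_(p, n)), (forall r k, phi *m mexp A r *m B k = 0) ->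
        phi *m z = phi *m mexp A s *m y.
Proof.
move=> hbar_gt0 eps0 [t timest [F [M [mu [M0 mu0 stab]]]]].
exists (M ^+ 2 / eps / (2 * mu)).
  by rewrite !divr_ge0 ?exprn_ge0 ?mulr_ge0// ltW.
move=> s s0s y; have s0 : 0 <= s.
  by apply: le_trans s0s; rewrite !divr_ge0 ?exprn_ge0 ?mulr_ge0// ltW.
exists (impulsive_solution A B F hbar_gt0 timest y s); last first.
  by move=> p phi phi0; exact: impulsive_solution_mod.
have := stab _ (impulsive_solutionP A B F hbar_gt0 timest y) s s0.
rewrite impulsive_solution0 => le_s.
rewrite !sqn_enorm; apply: le_trans (_ : (M * expR (- mu * s) * enorm y) ^+ 2 <= _).
  by rewrite lerXn2r// nnegrE ?enorm_ge0 ?mulr_ge0 ?expR_ge0 ?enorm_ge0// ltW.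
rewrite exprMn ler_wpM2r ?sqr_ge0// exprMn -expRM_natl mulNr mulrN expRN.
rewrite ler_pdivrMr ?expR_gt0//.
apply: le_trans (_ : eps * (1 + 2%:R * (mu * s)) <= _); last first.
  by rewrite ler_wpM2l ?(ltW eps0)// expR_ge1Dx.
move: s0s; rewrite !ler_pdivrMr ?mulr_gt0// => le1.
by nra.
Qed.

End Flow.

(** * Steering by impulses and the stabilizing feedback *)

Section Reachability.
Variable R : realType.

Lemma mul_row_col_entry p n q (X : 'M[R]_(p, n)) (Y : 'M[R]_(n, q)) i j :
  (row i X *m col j Y) 0 0 = (X *m Y) i j.
Proof. by rewrite !mxE; apply: eq_bigr => l _; rewrite !mxE. Qed.

(** A matrix whose columns are killed by everything that kills the columns of
    the [W l] is a combination of the [W l]. *)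
Lemma column_span n m c L (W : 'I_L -> 'M[R]_(n, m)) (C : 'M[R]_(n, c)) :
  (forall phi : 'M[R]_n, (forall l, phi *m W l = 0) -> phi *m C = 0) ->
  exists U : 'I_L -> 'M[R]_(m, c), C = \sum_l W l *m U l.
Proof.
move=> annC; pose Z := \mxrow_(l < L) W l.
have /submxP[X XE] : (C^T <= Z^T)%MS.
  rewrite submxE; apply/eqP/trmx_inj; rewrite trmx0 trmx_mul trmxK.
  apply: annC => l; have /mxrowP/(_ l) : (cokermx Z^T)^T *m Z = 0.
    by apply: trmx_inj; rewrite trmx_mul trmxK mulmx_coker trmx0.
  rewrite mul_mxrow mxrowK => ->.
  by apply/matrixP => i j; rewrite !mxE.
exists (fun l => submxcol X^T l).
rewrite -mul_mxrow_mxcol submxcolK -/Z; apply: trmx_inj.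
by rewrite trmx_mul trmxK.
Qed.

Lemma leq_qmax n k (A : 'M[R]_n) (D : 'M[R]_(n, k)) c :
  (\dim (krylov A (col c D)) <= qmax A D)%N.
Proof.
exact: (@leq_bigmax _ (fun c : 'I_k => \dim (krylov A (col c D)) : nat) c).
Qed.

Lemma leq_krylov_qmax n m hbar (A : 'M[R]_n) (B : 'I_hbar -> 'M[R]_(n, m)) k c :
  (\dim (krylov A (col c (B k))) <= qmax A (\mxrow_(k < hbar) B k)%R)%N.
Proof.
have -> : col c (B k) = col (tagnat.Rank k c) (\mxrow_(k < hbar) B k).
  rewrite -[in LHS](mxrowK B k); apply/matrixP => i j; by rewrite !mxE.
exact: leq_qmax.
Qed.

Section Steering.
Variables (n m hbar : nat) (A : 'M[R]_n.+1) (B : 'I_hbar -> 'M[R]_(n.+1, m)).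
Variables (t : nat -> R) (hbar_gt0 : (0 < hbar)%N).
Hypothesis timest : impulse_times hbar t.

Let T := t hbar.
Let q := qmax A (\mxrow_(k < hbar) B k)%R.
Hypothesis nonpathological : ((q%:R * T)%:E < dA A)%E.

Let E i := mexp A (t i.+2 - t i.+1).
Let b i := B (phase hbar_gt0 i).

Let T_gt0 : 0 < T. Proof. exact: (impulse_times_period_gt0 hbar_gt0 timest). Qed.

Let s_per i k : t (i + k * hbar).+1 = t i.+1 + k%:R * T.
Proof. by rewrite -addSn (impulse_times_period timest). Qed.

Let E_per i : E (i + hbar) = E i.
Proof.
rewrite /E -addSn -[hbar in X in X - _]mul1n -[hbar in X in _ - X]mul1n.
by rewrite !s_per opprD addrACA subrr addr0.
Qed.

Lemma phase_mulper i k : phase hbar_gt0 (i + k * hbar) = phase hbar_gt0 i.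
Proof. by apply: val_inj; rewrite /= addnC modnMDl. Qed.

Let b_per i : b (i + hbar) = b i.
Proof. by rewrite /b; have := phase_mulper i 1; rewrite mul1n => ->. Qed.

(** Over [p >= q] periods, what annihilates the effect of every impulse at
    the final instant annihilates the whole controllable subspace. *)
Lemma steering_annihilator p w (phi : 'M[R]_(w, n.+1)) : (q <= p)%N ->
  (forall l, (l < p * hbar)%N ->
     phi *m (mexp A (t (p * hbar).+1 - t l.+1) *m b l) = 0) ->
  forall s k, phi *m mexp A s *m B k = 0.
Proof.
move=> qp phi0 s k; apply/matrixP => i j.
rewrite [RHS]mxE -mul_row_col_entry row_mul.
(* The impulses of phase k occur at the instants t k.+1 + j T, j < p, so that
   the q output zeros below are equally spaced and end at t L.+1 - t k.+1,
   where L = p hbar. *)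
apply: (observed_eq0_sampled (q := q) (T := T)
  (t0 := t (p * hbar).+1 - t k.+1 - (p.-1)%:R * T)) => //.
  exact: leq_krylov_qmax.
move=> a aq; have ap : (a < p)%N := leq_trans aq qp.
pose l := (k + (p.-1 - a) * hbar)%N.
have lp : (l < p * hbar)%N.
  rewrite /l -[p in (_ < p * _)%N](prednK (leq_ltn_trans (leq0n a) ap)) mulSn.
  by rewrite -addSn leq_add// leq_mul2r leq_subr orbT.
have -> : t (p * hbar).+1 - t k.+1 - p.-1%:R * T + a%:R * T =
    t (p * hbar).+1 - t l.+1.
  have ap1 : (a <= p.-1)%N by rewrite -ltnS (prednK (leq_ltn_trans (leq0n a) ap)).
  by rewrite /l s_per natrB//; ring.
rewrite /observed -row_mul mul_row_col_entry.
have := phi0 l lp; rewrite /b.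
have -> : phase hbar_gt0 l = k.
  by rewrite phase_mulper; apply: val_inj; rewrite /= modn_small.
by rewrite mulmxA => ->; rewrite mxE.
Qed.

(** The variation of constants formula. *)
Lemma trajectory_closed_form x u l : trajectory E b 0 x u l =
  mexp A (t l.+1 - t 1%N) *m x +
  \sum_(l' < l) mexp A (t l.+1 - t l'.+1) *m (b l' *m u l').
Proof.
elim: l => [|l IH] /=.
  by rewrite subrr mexp0 mul1mx big_ord0 addr0.
rewrite IH add0n big_ord_recr /= !mulmxDr -addrA; congr (_ + _).
  by rewrite /E mulmxA -mexpD addrA subrK.
congr (_ + _); rewrite mulmx_sumr; apply: eq_bigr => l' _.
by rewrite /E mulmxA -mexpD addrA subrK.
Qed.

Lemma trajectory_linear (U : nat -> 'M[R]_(m, n.+1)) l :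
  exists X : 'M[R]_n.+1, forall x,
    trajectory E b 0 x (fun l => U l *m x) l = X *m x.
Proof.
elim: l => [|l [X XE]] /=; first by exists 1%:M => x; rewrite mul1mx.
exists (E (0 + l) *m (X + b (0 + l) *m U l)) => x.
by rewrite XE -mulmxA mulmxDl !mulmxA.
Qed.

Hypothesis stabAB : pair_stabilizable A B.

(** For large [s], some matrix of small norm agrees with [exp(s A)] modulo the
    controllable subspace. *)
Lemma small_target : exists2 s0 : R, 0 <= s0 & forall s, s0 <= s ->
  exists2 Z : 'M[R]_n.+1, (forall x, sqn (Z *m x) <= 2^-1 * sqn x) &
    forall phi : 'M[R]_n.+1, (forall r k, phi *m mexp A r *m B k = 0) ->
      phi *m Z = phi *m mexp A s.
Proof.
(* The columns of Z approximate those of exp(s A); one factor N of the accuracy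
   comes from psd_le_trace, the other from summing over the columns. *)
pose N : R := n.+1%:R.
have N0 : 0 < N by rewrite ltr0n.
have eps0 : 0 < (2 * (N * N))^-1 by rewrite invr_gt0 !mulr_gt0.
have [s0 s0_ge0 decay] := pair_stabilizable_decay hbar_gt0 eps0 stabAB.
exists s0 => // s /decay{}decay.
pose e i : 'cV[R]_n.+1 := delta_mx i 0.
have /choice[z zP] i : exists z : 'cV[R]_n.+1, sqn z <= (2 * (N * N))^-1 /\
    forall phi : 'M[R]_n.+1, (forall r k, phi *m mexp A r *m B k = 0) ->
      phi *m z = phi *m mexp A s *m e i.
  have [z zs zphi] := decay (e i); exists z; split; last exact: zphi.
  rewrite (le_trans zs)// [sqn _](_ : _ = 1) ?mulr1//.
  rewrite /sqn (bigD1 i)//= mxE !eqxx expr1n big1 ?addr0// => j ji.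
  by rewrite mxE (negbTE ji) expr0n.
pose Z : 'M[R]_n.+1 := \sum_i z i *m delta_mx 0 i.
exists Z => [x|phi phi0]; last first.
  rewrite mulmx_sumr; under eq_bigr do rewrite mulmxA (zP _).2// -mulmxA mul_delta_mx.
  by rewrite -mulmx_sumr -mx1_sum_delta mulmx1.
have Ze i : Z *m e i = z i.
  rewrite mulmx_suml (bigD1 i)//= big1 ?addr0 => [|j ji].
    by rewrite -mulmxA mul_delta_mx (_ : delta_mx 0 0 = 1%:M) ?mulmx1// mx1_sum_delta big_ord1.
  by rewrite -mulmxA mul_delta_mx_0 ?mulmx0// eq_sym.
have psdZ : psd (Z^T *m 1%:M *m Z) by apply/psd_congr/psd1.
rewrite sqnE -bil_congr; apply: le_trans (psd_le_trace x psdZ) _.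
rewrite ler_wpM2r ?sqn_ge0//.
under eq_bigr do rewrite bil_congr -sqnE Ze.
apply: (@le_trans _ _ (N * \sum_(i < n.+1) (2 * (N * N))^-1)).
  by rewrite ler_wpM2l ?ler0n//; apply: ler_sum => i _; exact: (zP i).1.
rewrite sumr_const card_ord -[_ *+ _]mulr_natl -/N.
rewrite [leLHS](_ : _ = 2^-1)//; field.
by rewrite gt_eqF.
Qed.

(** Controls over [p] periods, linear in the initial state, that send [x] to
    [Z x] with [Z] as in [small_target], and hence halve its squared norm. *)
Lemma steering_contraction : exists (a : R) (p : nat),
  [/\ 0 <= a, (0 < p)%N & forall x, exists u : nat -> 'cV[R]_m,
    \sum_(l < p * hbar) (sqn (trajectory E b 0 x u l) + sqn (u l)) <= a * sqn x /\
    sqn (trajectory E b 0 x u (p * hbar)) <= 2^-1 * sqn x].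
Proof.
have [s0 _ target] := small_target.
(* p is large enough both for reachability and for the target to be small. *)
pose p := (maxn q (Num.truncn (s0 / T)).+1).
have [Z Zsmall Zphi] : exists2 Z : 'M[R]_n.+1,
    (forall x, sqn (Z *m x) <= 2^-1 * sqn x) &
    forall phi : 'M[R]_n.+1, (forall r k, phi *m mexp A r *m B k = 0) ->
      phi *m Z = phi *m mexp A (t (p * hbar).+1 - t 1%N).
  apply: target; rewrite -[(p * hbar)%N]add0n s_per addrAC subrr add0r.
  rewrite -ler_pdivrMr// (le_trans (ltW (truncnS_gt _)))// ler_nat.
  exact: leq_maxr.
pose W (l : 'I_(p * hbar)) := mexp A (t (p * hbar).+1 - t l.+1) *m b l.
have [U UE] : exists U : 'I_(p * hbar) -> 'M[R]_(m, n.+1),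
    Z - mexp A (t (p * hbar).+1 - t 1%N) = \sum_l W l *m U l.
  apply: column_span => phi phiW; rewrite mulmxBr Zphi ?subrr// => r k.
  apply: (steering_annihilator (p := p)); first exact: leq_maxl.
  by move=> l lp; exact: (phiW (Ordinal lp)).
pose U' l := if insub l is Some l' then U l' else 0.
have U'E (l : 'I_(p * hbar)) : U' l = U l by rewrite /U' valK.
have /choice[X XE] := trajectory_linear U'.
have /choice[c cP] l : exists c : R, 0 <= c /\ forall x, sqn (X l *m x) <= c * sqn x.
  by have [c c0 cX] := sqn_mulmx_bound (X l); exists c.
have /choice[d dP] l : exists d : R, 0 <= d /\ forall x, sqn (U' l *m x) <= d * sqn x.
  by have [d d0 dX] := sqn_mulmx_bound (U' l); exists d.
exists (\sum_(l < p * hbar) (c l + d l)), p; split.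
- by apply: sumr_ge0 => l _; rewrite addr_ge0 ?(cP l).1 ?(dP l).1.
- by rewrite leq_max orbT.
move=> x; exists (fun l => U' l *m x); split.
  rewrite mulr_suml; apply: ler_sum => l _.
  by rewrite XE mulrDl lerD ?(cP l).2 ?(dP l).2.
rewrite trajectory_closed_form.
under eq_bigr do rewrite U'E !mulmxA -/(W _).
rewrite [X in sqn X](_ : _ = Z *m x)//.
rewrite -[Z](subrK (mexp A (t (p * hbar).+1 - t 1%N))) UE mulmxDl addrC.
by rewrite mulmx_suml.
Qed.

(** A feedback of period [hbar] together with a Lyapunov function for the states
    at the impulse instants. *)
Lemma impulse_lyapunov :
  exists (F : 'I_hbar -> 'M[R]_(m, n.+1)) (W : nat -> 'cV[R]_n.+1 -> R) (c : R),
  [/\ 0 < c, forall i x, sqn x <= W i x <= c * sqn x &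
      forall i x, W i.+1 (mexp A (t i.+2 - t i.+1) *m
          (x + B (phase hbar_gt0 i) *m (F (phase hbar_gt0 i) *m x))) <=
        W i x - 2^-1 * sqn x].
Proof.
have [a [p [a0 p0 contr]]] := steering_contraction.
have [F [W [c [c0 Fper Wc WF]]]] :=
  periodic_lyapunov_feedback hbar_gt0 E_per b_per a0 p0 contr.
exists (fun k => F k), W, c; split=> // i x.
have -> : F (phase hbar_gt0 i) = F i.
  rewrite /= [in RHS](divn_eq i hbar) addnC.
  by elim: (i %/ hbar)%N => [|r IH]; rewrite ?addn0// mulSn addnCA addnC Fper.
exact: WF.
Qed.

End Steering.
End Reachability.

(** * Exponential stability *)

Section Decay.
Variable R : realType.

(** The exponential is bounded on compact intervals of time. *)
Lemma mexp_bounded n (A : 'M[R]_n) (T : R) : 0 <= T ->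
  exists2 K : R, 0 <= K &
    forall s, 0 <= s <= T -> forall x, sqn (mexp A s *m x) <= K * sqn x.
Proof.
move=> T0.
pose f s : R := \sum_(j < n) \sum_(i < n) mexp A s i j ^+ 2.
have fc : continuous f.
  move=> s; apply/differentiable_continuous/derivable1_diffP.
  have -> : f = \sum_(j < n) \sum_(i < n) (fun s => mexp A s i j ^+ 2).
    apply/funext => r; rewrite fct_sumE; apply: eq_bigr => j _.
    by rewrite fct_sumE.
  apply: derivable_sum => j; apply: derivable_sum => i.
  by have := mderiv_mexp A s i j => ?; apply: ex_derive.
have [r _ fr] := EVT_max T0 (continuous_subspaceT fc).
have f_ge0 s : 0 <= f s by do 2! apply: sumr_ge0 => ? _; exact: sqr_ge0.
exists (n%:R * f r); first by rewrite mulr_ge0.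
move=> s sT x; have psdE : psd ((mexp A s)^T *m 1%:M *m mexp A s).
  exact/psd_congr/psd1.
rewrite sqnE -bil_congr; apply: le_trans (psd_le_trace x psdE) _.
rewrite ler_wpM2r ?sqn_ge0// ler_wpM2l//.
apply: le_trans (fr s _); last by rewrite in_itv.
rewrite le_eqVlt /f; apply/orP; left; apply/eqP; apply: eq_bigr => j _.
rewrite bil_congr -sqnE -colE; apply: eq_bigr => i _.
by rewrite mxE.
Qed.

Section FeedbackStability.
Variables (n m hbar : nat) (A : 'M[R]_n).
Variables (B : 'I_hbar -> 'M[R]_(n, m)) (F : 'I_hbar -> 'M[R]_(m, n)).
Variables (t : nat -> R) (hbar_gt0 : (0 < hbar)%N).
Hypothesis timest : impulse_times hbar t.
Variables (W : nat -> 'cV[R]_n -> R) (c : R).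
Hypothesis c_gt0 : 0 < c.
Hypothesis Wc : forall i x, sqn x <= W i x <= c * sqn x.
Hypothesis W_decr : forall i x, W i.+1 (mexp A (t i.+2 - t i.+1) *m
    (x + B (phase hbar_gt0 i) *m (F (phase hbar_gt0 i) *m x))) <=
  W i x - 2^-1 * sqn x.

Let T := t hbar.
(* The decay rate: over one period, 1 - 1 / (2 c) <= exp(- nu T). *)
Let nu : R := (2 * c * T)^-1.

Let T_gt0 : 0 < T. Proof. exact: (impulse_times_period_gt0 hbar_gt0 timest). Qed.

(** The Lyapunov function decays exponentially in time, because consecutive
    impulses are at most one period apart. *)
Lemma lyapunov_decay x : closed_loop_solution A B F t x -> forall i,
  W i (x (t i.+1)) <= expR (- nu * (t i.+1 - t 1%N)) * W 0%N (x (t 1%N)).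
Proof.
move=> sol; elim=> [|i IH]; first by rewrite subrr mulr0 expR0 mul1r.
have tS : t i.+1 < t i.+2 by case: timest.
have xS := closed_loop_flow hbar_gt0 timest sol (i := i) (s := t i.+2).
rewrite xS ?tS ?lexx//.
set v := x (t i.+1) in IH *.
have Wv : W i v - 2^-1 * sqn v <= (1 - (2 * c)^-1) * W i v.
  have /andP[_ /(ler_wpM2l (ltW (_ : 0 < (2 * c)^-1)))] := Wc i v.
  rewrite invr_gt0 mulr_gt0// => /(_ isT).
  rewrite invfM mulrA -[_ * c^-1 * c]mulrA mulVf ?gt_eqF// mulr1; lra.
have W_ge0 : 0 <= W i v by have /andP[+ _] := Wc i v; apply/le_trans/sqn_ge0.
apply: le_trans (W_decr i v) (le_trans Wv _).
have le_exp : 1 - (2 * c)^-1 <= expR (- nu * (t i.+2 - t i.+1)).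
  apply: le_trans (expR_ge1Dx _) _; rewrite ler_expR mulNr lerN2.
  have gap : t i.+2 - t i.+1 <= T.
    by rewrite lerBlDl; exact: (impulse_times_gap hbar_gt0 timest).
  apply: le_trans (ler_wpM2l _ gap) _.
    by rewrite invr_ge0 !mulr_ge0// ltW.
  by rewrite /nu invfM -mulrA mulVf ?mulr1// gt_eqF.
apply: le_trans (ler_wpM2r W_ge0 le_exp) _.
apply: le_trans (ler_wpM2l (expR_ge0 _) IH) _.
by rewrite mulrA -expRD -mulrDr addrA subrK.
Qed.

(** Between impulses the state is bounded by its value at the last impulse, which
    the Lyapunov function controls. *)
Lemma feedback_stable : closed_loop_stable A B F t.
Proof.
have [K K0 KE] := mexp_bounded A (ltW T_gt0).
have /choice[J JP] (k : 'I_hbar) : exists J : R, 0 <= J /\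
    forall x, sqn (x + B k *m (F k *m x)) <= J * sqn x.
  have [J J0 JE] := sqn_mulmx_bound (1%:M + B k *m F k); exists J; split=> // x.
  by have := JE x; rewrite mulmxDl mul1mx mulmxA.
pose J' := \sum_k J k.
have J'0 : 0 <= J' by apply: sumr_ge0 => k _; exact: (JP k).1.
have J'E k x : sqn (x + B k *m (F k *m x)) <= J' * sqn x.
  rewrite (le_trans ((JP k).2 x))// ler_wpM2r ?sqn_ge0// /J' (bigD1 k)//= lerDl.
  by apply: sumr_ge0 => l _; exact: (JP l).1.
have nu0 : 0 < nu by rewrite invr_gt0 !mulr_gt0.
(* Within one period, K bounds the free flow and J' the jumps.  The summand
   K J' c K is for the times after the first impulse, K for those before; the
   exponential pays for the decay not counted on the first and last intervals. *)
pose C := (K * J' * c * K + K) * expR (2 * nu * T) + 1.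
have C0 : 0 < C.
  by rewrite ltr_wpDl// mulr_ge0 ?expR_ge0// addr_ge0// !mulr_ge0// ltW.
have t0 : t 0%N = 0 by case: timest.
have t1T : t 1%N <= T by have := impulse_times_gap hbar_gt0 timest 0; rewrite t0 add0r.
have t1_ge0 : 0 <= t 1%N by rewrite -t0; exact: (impulse_times_ltW timest).
exists (Num.sqrt C), (nu / 2); split; rewrite ?sqrtr_gt0 ?divr_gt0// => x sol s s0.
suff le_s : sqn (x s) <= C * expR (- nu * s) * sqn (x 0).
  rewrite -(ler_pXn2r (_ : 0 < 2)%N)// ?nnegrE ?enorm_ge0//; last first.
    by rewrite !mulr_ge0 ?sqrtr_ge0 ?expR_ge0 ?enorm_ge0.
  rewrite -sqn_enorm (le_trans le_s)// !exprMn -sqn_enorm sqr_sqrtr ?(ltW C0)//.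
  rewrite -expRM_natl (_ : 2 * (- (nu / 2) * s) = - nu * s)//.
  by rewrite mulNr mulrN mulrA mulrCA divff ?mulr1 // mulNr.
have x1 : sqn (x (t 1%N)) <= K * sqn (x 0).
  rewrite (closed_loop_flow0 timest sol) ?t1_ge0 ?lexx//.
  by apply: KE; rewrite t1_ge0.
have [st1|st1] := leP s (t 1%N).
  rewrite (closed_loop_flow0 timest sol) ?s0//.
  apply: le_trans (KE _ _ _) _; first by rewrite s0 (le_trans st1).
  rewrite ler_wpM2r ?sqn_ge0//.
  apply: (@le_trans _ _ (K * expR (2 * nu * T) * expR (- nu * s))).
    rewrite -mulrA -expRD ler_peMr// -[leLHS]expR0 ler_expR.
    have : nu * s <= nu * T by rewrite ler_wpM2l ?(ltW nu0)// (le_trans st1).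
    have : 0 <= nu * T by rewrite mulr_ge0// ltW.
    lra.
  rewrite ler_wpM2r ?expR_ge0// /C.
  have : 0 <= (K * J' * c * K) * expR (2 * nu * T).
    by rewrite mulr_ge0 ?expR_ge0// !mulr_ge0// ltW.
  lra.
have [[|i] /andP[ts st]] := impulse_times_locate hbar_gt0 timest (le_lt_trans t1_ge0 st1).
  by move: st1; rewrite ltNge st.
rewrite (closed_loop_flow hbar_gt0 timest sol (i := i)) ?ts//.
set v := x (t i.+1).
have gap : s <= t i.+1 + T by apply: le_trans st (impulse_times_gap hbar_gt0 timest _).
apply: (@le_trans _ _ (K * (J' * sqn v))).
  apply: (le_trans (KE _ _ _)); last by rewrite ler_wpM2l.
  by rewrite subr_ge0 (ltW ts)/= lerBlDl.
apply: (@le_trans _ _ (K * J' * (expR (2 * nu * T) * expR (- nu * s) *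
   (c * (K * sqn (x 0)))))).
  rewrite mulrA ler_wpM2l ?mulr_ge0//.
  have /andP[sW _] := Wc i v.
  apply: (le_trans sW) (le_trans (lyapunov_decay sol i) _).
  have W0 : 0 <= W 0%N (x (t 1%N)).
    by have /andP[+ _] := Wc 0%N (x (t 1%N)); apply/le_trans/sqn_ge0.
  apply: ler_pM; rewrite ?expR_ge0//.
    rewrite -expRD ler_expR -mulrA.
    have h1 : nu * s <= nu * (t i.+1 + T) by rewrite ler_wpM2l// ltW.
    have h2 : nu * t 1%N <= nu * T by rewrite ler_wpM2l// ltW.
    lra.
  have /andP[_ Wle] := Wc 0%N (x (t 1%N)).
  by apply: le_trans Wle _; rewrite ler_wpM2l// ltW.
rewrite [leLHS](_ : _ = K * J' * c * K * expR (2 * nu * T) * expR (- nu * s)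
   * sqn (x 0)); last by ring.
rewrite ler_wpM2r ?sqn_ge0// ler_wpM2r ?expR_ge0// /C.
have : 0 <= K * expR (2 * nu * T) by rewrite mulr_ge0 ?expR_ge0.
lra.
Qed.

End FeedbackStability.
End Decay.

Theorem theorem1p3 (R : realType) (n m hbar : nat)
  (n_gt0 : (0 < n)%N) (m_gt0 : (0 < m)%N) (hbar_gt0 : (0 < hbar)%N)
  (A : 'M[R]_n) (B : 'I_hbar -> 'M[R]_(n, m)) :
  pair_stabilizable A B ->
  forall t : nat -> R,
    impulse_times hbar t ->
    dense_times hbar A (\mxrow_(k < hbar) B k)%R t ->
    system_stabilizable A B t.
Proof.
case: n n_gt0 A B => // n _ A B stabAB t timest dense.
have small_period := dense_times_period hbar_gt0 timest dense.
have [F [W [c [c0 Wc WF]]]] :=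
  impulse_lyapunov hbar_gt0 timest small_period stabAB.
by exists F; exact: (feedback_stable timest c0 Wc WF).
Qed.
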